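(* Let $d\ge 1$, let $\alpha_{\infty,1},\dots,\alpha_{\infty,d}$ be non-zero, pairwise distinct real numbers, and let $F_\infty=\sum_{i=1}^d \alpha_{\infty,i}(N_i^2-1)$, where $N_1,\dots,N_d$ are i.i.d. standard Gaussian random variables. Let $\mathcal{A}_\infty$ be the differential operator of order $d$ associated with $F_\infty$, $$\mathcal{A}_\infty f(x)=\sum_{l=2}^{d+1}(b_l-a_{l-1}x)\,f^{(d+2-l)}(x)-a_{d+1}\,x\,f(x),$$ with coefficients $a_l$, $b_l$ as defined in the context. Let $F$ be a centered random variable living in a finite sum of Wiener chaoses. Then $F$ and $F_\infty$ have the same distribution if and only if $\mathbb{E}[\mathcal{A}_\infty f(F)]=0$ for all polynomials $f:\mathbb{R}\to\mathbb{R}$.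
   Context: Polynomial: $P(x)=x\prod_{i=1}^d(x-\alpha_{\infty,i})$, of degree $d+1$. Coefficients: for $1\le l\le d+1$, $a_l=\dfrac{P^{(l)}(0)}{l!\,2^{l-1}}$; for $2\le l\le d+1$, $b_l=\sum_{r=l}^{d+1}\dfrac{a_r}{(r-l+1)!}\,\kappa_{r-l+2}(F_\infty)$, where $\kappa_r(X)$ denotes the $r$-th cumulant of a random variable $X$ (equivalently $b_l=\sum_{r=l}^{d+1}a_r\,\mathbb{E}[\Gamma_{r-l+1}(F_\infty)]$, where $\Gamma_0(F)=F$, $\Gamma_i(F)=\langle DF,-DL^{-1}\Gamma_{i-1}(F)\rangle_{\mathfrak{H}}$ are the iterated Malliavin Gamma operators, with $D$ the Malliavin derivative and $L^{-1}$ the pseudo-inverse of the Ornstein-Uhlenbeck generator, which satisfy $\kappa_{r+1}(F)=r!\,\mathbb{E}[\Gamma_r(F)]$). $F$ lives in a finite sum of Wiener chaoses if, for some isonormal Gaussian process over a real separable Hilbert space $\mathfrak{H}$ and some $M<\infty$, $F$ belongs to the direct sum of the Wiener chaoses of orders $0,1,\dots,M$ of that process. Centered means $\mathbb{E}[F]=0$. *)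

(* Defs.v *)
From HB Require Import structures.
From mathcomp Require Import all_boot all_order all_algebra.
From mathcomp Require Import all_classical all_reals all_analysis.
From mathcomp Require Import measurable_realfun.

Set Implicit Arguments.
Unset Strict Implicit.
Unset Printing Implicit Defensive.

Import Order.TTheory GRing.Theory Num.Theory.
Import numFieldNormedType.Exports.

Local Open Scope classical_set_scope.
Local Open Scope ring_scope.

Definition same_distribution (R : realType) (disp disp' : measure_display)
    (T : measurableType disp) (T' : measurableType disp')
    (P : probability T R) (P' : probability T' R)
    (X : {RV P >-> R}) (Y : {RV P' >-> R}) : Prop :=
  forall A : set R, measurable A -> distribution P X A = distribution P' Y A.

Definition standard_gaussian (R : realType) (disp : measure_display)
    (T : measurableType disp) (P : probability T R) (X : {RV P >-> R}) : Prop :=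
  forall A : set R, measurable A -> distribution P X A = normal_prob 0 1 A.

(* The case s = 0, where [normal_prob 0 s] has a junk value, is the degenerate
   Gaussian law. *)
Definition centered_gaussian (R : realType) (disp : measure_display)
    (T : measurableType disp) (P : probability T R) (X : {RV P >-> R}) : Prop :=
  exists s : R, forall A : set R, measurable A ->
    distribution P X A = if s == 0 then \d_(0 : R) A else normal_prob 0 s A.

(* The product rule over subfamilies is the special case where some of the
   [B i] are the whole line. *)
Definition mutually_independent (R : realType) (disp : measure_display)
    (T : measurableType disp) (P : probability T R) (d : nat)
    (X : 'I_d -> {RV P >-> R}) : Prop :=
  forall B : 'I_d -> set R, (forall i, measurable (B i)) ->
    P (\bigcap_(i in [set: 'I_d]) (X i @^-1` B i)) =
    (\prod_(i < d) P (X i @^-1` B i))%E.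

Fixpoint hermite (R : realType) (n : nat) : {poly R} :=
  if n is m.+1 then 'X * hermite R m - deriv (hermite R m) else 1.

(* The norm of the complete space H is the one induced by the inner product. *)
Definition real_hilbert (R : realType) (H : completeNormedModType R)
    (dot : {dot H for idfun}) : Prop :=
  forall h : H, dot h h = `|h| ^+ 2.

Definition separable (T : topologicalType) : Prop :=
  exists2 D : set T, countable D & dense D.

Definition isonormal (R : realType) (disp : measure_display)
    (T : measurableType disp) (P : probability T R)
    (H : completeNormedModType R) (dot : {dot H for idfun})
    (W : H -> {RV P >-> R}) : Prop :=
  (forall (m : nat) (c : 'I_m -> R) (h : 'I_m -> H),
     centered_gaussian (P := P) (\sum_(k < m) c k *: W (h k))) /\
  (forall g h : H, 'E_P[fun w => (W g w * W h w)%R] = (dot g h)%:E)%E.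

(* L^2-closure of the span of the Hermite polynomials in the W h, `|h| = 1;
   the order 0 chaos is the space of constants, also when H = 0. *)
Definition wiener_chaos (R : realType) (disp : measure_display)
    (T : measurableType disp) (P : probability T R)
    (H : completeNormedModType R) (W : H -> {RV P >-> R})
    (n : nat) (F : {RV P >-> R}) : Prop :=
  if n is 0 then exists c : R, {ae P, forall w, F w = c}
  else forall eps : R, 0 < eps ->
    exists (m : nat) (c : 'I_m -> R) (h : 'I_m -> H),
      (forall k, `|h k| = 1) /\
      ('N[P]_2%:E[(fun w =>
          (F w - \sum_(k < m) c k * (hermite R n).[W (h k) w])%R%:E)] < eps%:E)%E.

Definition in_finite_sum_of_chaoses (R : realType) (disp : measure_display)
    (T : measurableType disp) (P : probability T R) (F : {RV P >-> R}) : Prop :=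
  exists (H : completeNormedModType R) (dot : {dot H for idfun})
         (W : H -> {RV P >-> R}),
    [/\ real_hilbert dot, separable H, isonormal dot W &
        exists (M : nat) (G : 'I_M.+1 -> {RV P >-> R}),
          (forall n : 'I_M.+1, wiener_chaos W n (G n)) /\
          {ae P, forall w, F w = \sum_(n < M.+1) G n w}].

(* r-th derivative at 0 of the cumulant generating function log E[exp(tX)];
   meaningful when X has finite exponential moments near 0, as is the case for
   [F_infty]. *)
Definition cumulant (R : realType) (disp : measure_display)
    (T : measurableType disp) (P : probability T R) (X : {RV P >-> R})
    (r : nat) : R :=
  derive1n r (fun t : R => ln (fine ('M_P X t))) 0.

Definition F_infty (R : realType) (disp : measure_display)
    (T : measurableType disp) (P : probability T R) (d : nat)
    (alpha : 'I_d -> R) (N : 'I_d -> {RV P >-> R}) : {RV P >-> R} :=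
  \sum_(i < d) alpha i *: ((N i : {mfun T >-> R}) ^+ 2 - 1).

Definition P_infty (R : realType) (d : nat) (alpha : 'I_d -> R) : {poly R} :=
  'X * \prod_(i < d) ('X - (alpha i)%:P).

Definition coef_a (R : realType) (d : nat) (alpha : 'I_d -> R) (l : nat) : R :=
  (derivn l (P_infty alpha)).[0] / (l`!%:R * 2 ^+ (l - 1)).

Definition coef_b (R : realType) (disp : measure_display)
    (T : measurableType disp) (P : probability T R) (d : nat)
    (alpha : 'I_d -> R) (N : 'I_d -> {RV P >-> R}) (l : nat) : R :=
  \sum_(l <= r < d.+2)
    coef_a alpha r / (r - l + 1)`!%:R * cumulant (F_infty alpha N) (r - l + 2).

Definition stein_op (R : realType) (disp : measure_display)
    (T : measurableType disp) (P : probability T R) (d : nat)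
    (alpha : 'I_d -> R) (N : 'I_d -> {RV P >-> R}) (f : R -> R) (x : R) : R :=
  \sum_(2 <= l < d.+2)
    (coef_b alpha N l - coef_a alpha (l - 1) * x) * derive1n (d + 2 - l) f x
  - coef_a alpha d.+1 * x * f x.

(* Main.v *)
(* If all E[A f(F)] vanish then, since oo - oo = -oo, every A f(F) is integrable;
   as A x^n = -a_{d+1} x^{n+1} + (terms of degree <= n) with a_{d+1} != 0, all
   moments of F exist and are determined recursively, hence equal those of
   F_oo, which satisfies the same identities. The law of F_oo has exponential
   moments, so it is determined by its moments.

   Stein identity for F_oo: with u_i = N_i^2, Gaussian integration by parts gives
   E[(u_i - 1) f(F)] = 2 alpha_i (E[(u_i - 1) f'(F)] + E[f'(F)]). Iterating it in
   sum_j a_{d+1-j} E[(u_i - 1) f^(j)(F)] leaves a boundary term whose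
   coefficient is a multiple of P(alpha_i) = 0; what remains, weighted by
   alpha_i and summed over i, is sum_n b_{d+2-n} E[f^(n)(F)].

   Determinacy: if E[p(X) cos(aX)] and E[p(X) sin(aX)] (p polynomial) agree for
   two laws with an exponential moment at a, Taylor expansion makes them agree
   near a, at a distance independent of a, hence everywhere. Polynomials in
   sin((x - c)/B) then have equal means, and (1 - w^n)^(n 2^n) with
   w = (1 + sin((x - c)/B))/2 converges boundedly to the indicator of x < c as
   n and then B tend to infinity. *)
Require Import Defs.
From HB Require Import structures.
From mathcomp Require Import all_boot all_order all_algebra.
From mathcomp Require Import all_classical all_reals all_analysis.
From mathcomp Require Import measurable_realfun.
From mathcomp Require Import ring lra zify.

Set Implicit Arguments.
Unset Strict Implicit.
Unset Printing Implicit Defensive.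

Import Order.TTheory GRing.Theory Num.Theory.
Import numFieldNormedType.Exports.

Local Open Scope classical_set_scope.
Local Open Scope ring_scope.

(** * Moment determinacy *)

Section same_mean.
Context {R : realType} (mu nu : probability R R).
Implicit Types f g : R -> R.

(** Integrability under both laws is included because [Rintegral] sends an infinite integral to the
    default value 0. With it, such functions form a vector space closed under dominated limits. *)
Definition same_mean f : Prop :=
  [/\ mu.-integrable setT (EFin \o f), nu.-integrable setT (EFin \o f) &
      \int[mu]_x f x = \int[nu]_x f x].

Lemma same_meanD f g : same_mean f -> same_mean g ->
  same_mean (fun x => f x + g x).
Proof.
move=> [mf nf ef] [mg ng eg]; split.
- exact: (integrableD measurableT mf mg).
- exact: (integrableD measurableT nf ng).
- by rewrite !RintegralD// ef eg.
Qed.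

Lemma same_meanZ (k : R) f : same_mean f -> same_mean (fun x => k * f x).
Proof.
move=> [mf nf ef]; split.
- exact: (integrableZl measurableT k mf).
- exact: (integrableZl measurableT k nf).
- by rewrite !RintegralZl// ef.
Qed.

Lemma same_meanB f g : same_mean f -> same_mean g ->
  same_mean (fun x => f x - g x).
Proof.
move=> sf /(same_meanZ (- 1)) /(same_meanD sf).
by under eq_fun do rewrite mulN1r.
Qed.

Lemma same_mean_cst (k : R) : same_mean (fun=> k).
Proof.
split; [exact: finite_measure_integrable_cst..|].
have one (m : probability R R) : \int[m]_x k = k.
  rewrite Rintegral_cst// (_ : fine _ = 1) ?mulr1//.
  exact: (congr1 fine (probability_setT m)).
by rewrite !one.
Qed.

Lemma same_mean_sum (I : Type) (s : seq I) (F : I -> R -> R) :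
  (forall i, same_mean (F i)) -> same_mean (fun x => \sum_(i <- s) F i x).
Proof.
move=> sF; elim: s => [|i s IHs].
  by under eq_fun do rewrite big_nil; exact: same_mean_cst.
by under eq_fun do rewrite big_cons; exact: same_meanD.
Qed.

(** Dominated convergence under each law separately; the limits agree because the two sequences of
    means coincide. *)
Lemma same_mean_lim (u : nat -> R -> R) f g :
  (forall n, same_mean (u n)) -> (forall x, u n x @[n --> \oo] --> f x) ->
  (forall n x, `|u n x| <= g x) ->
  mu.-integrable setT (EFin \o g) -> nu.-integrable setT (EFin \o g) ->
  same_mean f.
Proof.
move=> su uf ug mg ng.
have dct (m : probability R R) :
    (forall n, m.-integrable setT (EFin \o u n)) ->
    m.-integrable setT (EFin \o g) ->
    m.-integrable setT (EFin \o f) /\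
    \int[m]_x u n x @[n --> \oo] --> \int[m]_x f x.
  move=> iu ig.
  have mu' n : measurable_fun setT (u n).
    by apply/measurable_EFinP; exact: measurable_int (iu n).
  have mf : measurable_fun setT f by exact: (measurable_fun_cvg mu').
  have [iF _ cvgF] : [/\ m.-integrable setT (EFin \o f),
      (\int[m]_x `|(EFin \o u n) x - (EFin \o f) x| @[n --> \oo] --> 0)%E &
      (\int[m]_x (EFin \o u n) x @[n --> \oo] --> \int[m]_x (EFin \o f) x)%E].
    apply: (dominated_convergence _ _ _ _ ig) => //.
    - by move=> n; exact: measurable_int (iu n).
    - exact/measurable_EFinP.
    - by apply/aeW => x _; apply: cvg_EFin; [exact: nearW|exact: uf].
    - by apply/aeW => x n _; rewrite lee_fin ug.
  split=> //; apply: fine_cvg; rewrite fineK//.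
  exact: integrable_fin_num iF.
have [i1 c1] := dct mu (fun n => let: And3 h _ _ := su n in h) mg.
have [i2 c2] := dct nu (fun n => let: And3 _ h _ := su n in h) ng.
split=> //; apply: cvg_unique c1 _ => //.
rewrite (_ : (fun n => _) = (fun n => \int[nu]_x u n x))//.
by apply/funext => n; case: (su n).
Qed.

End same_mean.

Lemma series_exp_coeff_le {R : realType} (x : R) n :
  0 <= x -> series (exp_coeff x) n <= expR x.
Proof.
move=> x0; have -> : expR x = limn (series (exp_coeff x)) by [].
apply: nondecreasing_cvgn_le; last exact: is_cvg_series_exp_coeff.
apply/nondecreasing_seqP => k; rewrite /series/= big_nat_recr//= lerDl.
by rewrite divr_ge0// exprn_ge0.
Qed.

(** * Trigonometric means from moments and exponential bounds *)

Section moment_determinacy.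
Context {R : realType} (mu nu : probability R R).
Variable eps : R.
Let E x : R := expR (eps * x) + expR (- (eps * x)).
Hypothesis eps_gt0 : 0 < eps.
Hypothesis same_mean_poly : forall p : {poly R}, same_mean mu nu (horner p).
Hypothesis mu_exp : mu.-integrable setT (EFin \o E).
Hypothesis nu_exp : nu.-integrable setT (EFin \o E).

(** The partial sums of the power series of f at h x are polynomials in x, so multiplying p c by
    them preserves equality of means; dominated convergence reaches the limit when 2 |h| <= eps.
    Asking just |e k| <= 1 covers cos and sin at once. *)
Lemma same_mean_mul_entire (c f : R -> R) (e : nat -> R) (h : R) :
  (forall x, `|c x| <= 1) ->
  (forall p : {poly R}, same_mean mu nu (fun x => p.[x] * c x)) ->
  (forall k, `|e k| <= 1) ->
  (forall z, series (fun k => e k * exp_coeff z k) n @[n --> \oo] --> f z) ->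
  `|h| *+ 2 <= eps ->
  forall p : {poly R}, same_mean mu nu (fun x => p.[x] * (c x * f (h * x))).
Proof.
move=> c1 pc e1 ef heps p.
pose u n x := p.[x] * c x * series (fun k => e k * exp_coeff (h * x) k) n.
pose g x := (p ^+ 2).[x] + E x.
(* |p| e^|hx| <= p^2 + e^(2|hx|), so that polynomial and exponential moments
   suffice for domination. *)
have bound n x : `|u n x| <= g x.
  rewrite /u /g !normrM expr2 hornerM.
  have S1 : `|series (fun k => e k * exp_coeff (h * x) k) n| <=
      expR (`|h| * `|x|).
    rewrite (le_trans (ler_norm_sum _ _ _))//.
    rewrite (le_trans _ (@series_exp_coeff_le _ _ n _)) ?mulr_ge0//.
    apply: ler_sum => k _; rewrite /exp_coeff/= !normrM.
    rewrite [X in _ * (_ * X)]ger0_norm ?invr_ge0// normrX normrM.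
    by rewrite ler_piMl// divr_ge0// exprn_ge0// mulr_ge0.
  apply: (@le_trans _ _ (`|p.[x]| * expR (`|h| * `|x|))).
    by apply: ler_pM => //; exact: ler_piMr.
  have q2 : p.[x] * p.[x] = `|p.[x]| ^+ 2 by rewrite real_normK// num_real.
  have E2 : expR (`|h| * `|x|) ^+ 2 <= E x.
    rewrite -expRM_natl mulrA mulr_natl /E.
    apply: (@le_trans _ _ (expR (eps * `|x|))).
      by rewrite ler_expR ler_wpM2r.
    have [_|_] := ger0P x; first by rewrite lerDl expR_ge0.
    by rewrite mulrN lerDr expR_ge0.
  rewrite q2; apply: le_trans (lerD (lexx _) E2).
  by move: `|p.[x]| (expR _) => a b; nra.
have ig (m : probability R R) :
    m.-integrable setT (EFin \o horner (p ^+ 2)) ->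
    m.-integrable setT (EFin \o E) -> m.-integrable setT (EFin \o g).
  by move=> ip iE; exact: (integrableD measurableT ip iE).
apply: (@same_mean_lim _ _ _ u _ g) => //.
- move=> n; rewrite (_ : u n = fun x =>
    (p * \poly_(k < n) (e k * h ^+ k / k`!%:R)).[x] * c x) //.
  apply/funext => x; rewrite hornerM horner_poly /u -!mulrA; congr (_ * _).
  rewrite mulrC /series/= big_mkord; congr (_ * _); apply: eq_bigr => k _.
  by rewrite /exp_coeff/= exprMn; ring.
- move=> x; rewrite mulrA; apply: cvgM; [exact: cvg_cst|exact: ef].
- by apply: ig => //; case: (same_mean_poly (p ^+ 2)).
- by apply: ig => //; case: (same_mean_poly (p ^+ 2)).
Qed.

(** All polynomial weights are carried along because expanding a further factor multiplies by
    polynomials in x; this makes the step from a to a + h repeatable. *)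
Let trig a := forall p : {poly R},
  same_mean mu nu (fun x => p.[x] * cos (a * x)) /\
  same_mean mu nu (fun x => p.[x] * sin (a * x)).

Let trig_step a h : `|h| *+ 2 <= eps -> trig a -> trig (a + h).
Proof.
move=> heps ta.
(* Both series are put in the form e_k z^k / k! with e_k in {-1, 0, 1}. *)
have cosE (z : R) : series (fun k => (~~ odd k)%:R * (-1) ^+ k./2 * exp_coeff z k) n
    @[n --> \oo] --> cos z.
  rewrite [series _](_ : _ = series (cos_coeff z)); last first.
    by congr series; apply/funext => k; rewrite /cos_coeff /exp_coeff/= !mulrA.
  rewrite [cos z](_ : _ = limn (series (cos_coeff z))); last by rewrite unlock.
  exact: is_cvg_series_cos_coeff.
have sinE (z : R) : series (fun k => (odd k)%:R * (-1) ^+ k.-1./2 * exp_coeff z k) n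
    @[n --> \oo] --> sin z.
  rewrite [series _](_ : _ = series (sin_coeff z)); last first.
    by congr series; apply/funext => k; rewrite /sin_coeff /exp_coeff/= !mulrA.
  rewrite [sin z](_ : _ = limn (series (sin_coeff z))); last by rewrite unlock.
  exact: is_cvg_series_sin_coeff.
have b01 (b : bool) k : `|b%:R * (-1) ^+ k| <= 1 :> R.
  by rewrite normrM normrX normrN1 expr1n mulr1; case: b;
    rewrite ?normr1 ?normr0.
have cos1 x : `|cos (a * x)| <= 1 by rewrite ler_norml cos_geN1 cos_le1.
have sin1 x : `|sin (a * x)| <= 1 by rewrite ler_norml sin_geN1 sin_le1.
have mulE c f e := @same_mean_mul_entire c f e h.
move=> p; split.
- under eq_fun do rewrite mulrDl cosD mulrBr.
  apply: same_meanB.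
  + by apply: (mulE (fun x => cos (a * x)) cos _ _ _ _ cosE) => // q;
      case: (ta q).
  + by apply: (mulE (fun x => sin (a * x)) sin _ _ _ _ sinE) => // q;
      case: (ta q).
- under eq_fun do rewrite mulrDl sinD mulrDr.
  apply: same_meanD.
  + by apply: (mulE (fun x => sin (a * x)) cos _ _ _ _ cosE) => // q;
      case: (ta q).
  + by apply: (mulE (fun x => cos (a * x)) sin _ _ _ _ sinE) => // q;
      case: (ta q).
Qed.

Let trigT a : trig a.
Proof.
(* The admissible step length eps / 2 does not depend on the point reached, so n + 1 equal steps
   lead from 0 to a. *)
have [n an] : exists n : nat, `|a / n.+1%:R| *+ 2 <= eps.
  have [n nb] : exists n : nat, `|a| *+ 2 / eps < n%:R.
    by exists (Num.bound (`|a| *+ 2 / eps)); apply: archi_boundP;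
      rewrite divr_ge0// ltW.
  exists n; rewrite normrM normrV ?unitfE// normr_nat -mulrnAl ler_pdivrMr//.
  by rewrite mulrC -ler_pdivrMr// (le_trans (ltW nb))// ler_nat.
suff tk k : trig (k%:R * (a / n.+1%:R)).
  by rewrite (_ : a = n.+1%:R * (a / n.+1%:R))// mulrC divfK.
elim: k => [|k IHk]; last by rewrite -natr1 mulrDl mul1r; exact: trig_step.
move=> p; split.
  by under eq_fun do rewrite mul0r mul0r cos0 mulr1; exact: same_mean_poly.
by under eq_fun do rewrite mul0r mul0r sin0 mulr0; exact: same_mean_cst.
Qed.

Let same_mean_cos a t : same_mean mu nu (fun x => cos (a * x + t)).
Proof.
have [c s] := trigT a 1.
have -> : (fun x => cos (a * x + t)) = fun x =>
    cos t * ((1 : {poly R}).[x] * cos (a * x)) -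
    sin t * ((1 : {poly R}).[x] * sin (a * x)).
  by apply/funext => x; rewrite cosD hornerC; ring.
by apply: same_meanB; exact: same_meanZ.
Qed.

(** sin u cos v = (sin (u + v) + sin (u - v)) / 2, and a shift by pi / 2 turns these sines back into
    cosines; hence the general frequency and phase in the induction on k. *)
Let same_mean_sinX_cos b phi k a t :
  same_mean mu nu (fun x => sin (b * x + phi) ^+ k * cos (a * x + t)).
Proof.
elim: k a t => [|k IHk] a t.
  by under eq_fun do rewrite expr0 mul1r; exact: same_mean_cos.
have -> : (fun x => sin (b * x + phi) ^+ k.+1 * cos (a * x + t)) = fun x =>
    2^-1 * (sin (b * x + phi) ^+ k *
      cos ((b + a) * x + (phi + t - pi / 2)) +
    sin (b * x + phi) ^+ k * cos ((b - a) * x + (phi - t - pi / 2))).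
  apply/funext => x; rewrite exprSr.
  rewrite (_ : (b + a) * x + (phi + t - pi / 2) =
    (b * x + phi) + (a * x + t) - pi / 2); last by ring.
  rewrite (_ : (b - a) * x + (phi - t - pi / 2) =
    (b * x + phi) - (a * x + t) - pi / 2); last by ring.
  by move: (b * x + phi) (a * x + t) => u v; rewrite !cosBpihalf sinD sinB;
    field.
by apply: same_meanZ; apply: same_meanD; exact: IHk.
Qed.

Lemma same_mean_poly_sin b phi (p : {poly R}) :
  same_mean mu nu (fun x => p.[sin (b * x + phi)]).
Proof.
under eq_fun do rewrite horner_coef.
apply: same_mean_sum => k; apply: same_meanZ.
have := same_mean_sinX_cos b phi k 0 0.
by under eq_fun do rewrite mul0r addr0 cos0 mulr1.
Qed.

End moment_determinacy.

(** * Half-lines from polynomials in sines *)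

Lemma bernoulli_ge {R : realDomainType} (y : R) m :
  0 <= y <= 1 -> 1 - m%:R * y <= (1 - y) ^+ m.
Proof.
move=> /andP[y0 y1]; elim: m => [|m IHm]; first by rewrite mul0r subr0.
rewrite exprS (le_trans _ (ler_wpM2l _ IHm)) ?subr_ge0//.
have : 0 <= m%:R * y * y by rewrite !mulr_ge0.
by rewrite -natr1; nra.
Qed.

(** With z = e^(-l), the bound e^((n+1) l) >= ((n+1) l)^2 / 2 leaves at most 2 / (l^2 (n+1)). The
    case z = 0, where [ln] has a default value, is set apart. *)
Lemma cvg_mulnX0 {R : realType} (z : R) :
  0 <= z < 1 -> n.+1%:R * z ^+ n.+1 @[n --> \oo] --> (0 : R).
Proof.
move=> /andP[]; rewrite le_eqVlt => /predU1P[<- _|z0 z1].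
  by under eq_fun do rewrite expr0n mulr0; exact: cvg_cst.
have l0 : 0 < - ln z by rewrite oppr_gt0 ln_lt0// z0 z1.
have zE : z = (expR (- ln z))^-1 by rewrite expRN invrK lnK.
move: (- ln z) l0 zE => l l0 ->.
apply: (@squeeze_cvgr _ _ _ _ (fun=> 0) (fun n => 2 / l ^+ 2 * harmonic n)).
- apply: nearW => n; rewrite mulr_ge0 ?exprn_ge0 ?invr_ge0 ?expR_ge0//=.
  rewrite exprVn -expRM_natl.
  have nl : 0 < n.+1%:R * l by rewrite mulr_gt0.
  have := expR_ge1Dxn 1 (ltW nl); rewrite (_ : 2`! = 2%N)// => le1.
  have le2 : (n.+1%:R * l) ^+ 2 / 2 <= expR (n.+1%:R * l).
    by apply: le_trans le1; rewrite lerDr.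
  have -> : 2 / l ^+ 2 * n.+1%:R^-1 = n.+1%:R * ((n.+1%:R * l) ^+ 2 / 2)^-1.
    by field; rewrite gt_eqF//= pnatr_eq0.
  rewrite ler_wpM2l// lef_pV2// ?posrE ?expR_gt0// divr_gt0//.
  by rewrite exprn_gt0.
- exact: cvg_cst.
- by rewrite -(mulr0 (2 / l ^+ 2)); apply: cvgM;
    [exact: cvg_cst|exact: cvg_harmonic].
Qed.

(** Below 1/2, Bernoulli's inequality gives the lower bound 1 - (n+1) (2 w)^(n+1). From 1/2 on,
    w^(n+1) >= 2^-(n+1) and 1 - x <= e^(-x) give the upper bound e^-(n+1) <= 1 / (n+1). *)
Lemma cvg_power_step {R : realType} (w : R) : 0 <= w <= 1 ->
  (1 - w ^+ n.+1) ^+ (n.+1 * 2 ^ n.+1) @[n --> \oo] --> ((w < 2^-1)%R%:R : R).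
Proof.
move=> /andP[w0 w1].
have v01 n : 0 <= 1 - w ^+ n.+1 <= 1.
  by rewrite subr_ge0 exprn_ile1//= gerBl exprn_ge0.
have [w2|w2] := ltP w.
- apply: (@squeeze_cvgr _ _ _ _
    (fun n => 1 - n.+1%:R * (2 * w) ^+ n.+1) (fun=> 1)).
  + apply: nearW => n; have /andP[v0 v1] := v01 n.
    rewrite exprn_ile1// andbT; have /andP[x0 x1] : 0 <= w ^+ n.+1 <= 1.
      by rewrite exprn_ge0//= exprn_ile1.
    rewrite (le_trans _ (bernoulli_ge _ _)) ?x0//.
    by rewrite exprMn natrM natrX mulrA.
  + rewrite -[X in _ --> X]subr0; apply: cvgB; first exact: cvg_cst.
    by apply: cvg_mulnX0; rewrite mulr_ge0//= mulrC -ltr_pdivlMr// div1r.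
  + exact: cvg_cst.
- apply: (@squeeze_cvgr _ _ _ _ (fun=> 0) harmonic).
  + apply: nearW => n; have /andP[v0 v1] := v01 n.
    rewrite exprn_ge0//=.
    have wn : 2^-1 ^+ n.+1 <= w ^+ n.+1 by rewrite lerXn2r ?nnegrE.
    apply: (@le_trans _ _ (expR (- 2^-1 ^+ n.+1) ^+ (n.+1 * 2 ^ n.+1))).
      rewrite lerXn2r ?nnegrE ?expR_ge0//.
      by rewrite (le_trans _ (expR_ge1Dx _))// lerD2l lerN2.
    rewrite -expRM_natl natrM natrX mulrN -mulrA -exprMn divff// expr1n mulr1.
    rewrite expRN lef_pV2 ?posrE ?expR_gt0//.
    by rewrite (le_trans _ (expR_ge1Dx _))// lerDr.
  + exact: cvg_cst.
  + exact: cvg_harmonic.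
Qed.

Section cdf_from_sines.
Context {R : realType} (mu nu : probability R R).
Hypothesis sines : forall b phi (p : {poly R}),
  same_mean mu nu (fun x => p.[sin (b * x + phi)]).

Let same_mean_sin_lt0 b phi :
  same_mean mu nu (fun x => (sin (b * x + phi) < 0)%R%:R).
Proof.
pose w : {poly R} := 2^-1 *: (1 + 'X).
pose p n := (1 - w ^+ n.+1) ^+ (n.+1 * 2 ^ n.+1).
have pE n y : (p n).[y] = (1 - (2^-1 * (1 + y)) ^+ n.+1) ^+ (n.+1 * 2 ^ n.+1).
  by rewrite /p /w !hornerE.
have w01 x : 0 <= 2^-1 * (1 + sin (b * x + phi)) <= 1.
  have := sin_geN1 (b * x + phi); have := sin_le1 (b * x + phi).
  by move: (sin _) => y y1 yN1; apply/andP; split; lra.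
apply: (@same_mean_lim _ _ _ (fun n x => (p n).[sin (b * x + phi)]) _ (fun=> 1)).
- by move=> n; exact: sines.
- move=> x; under eq_fun do rewrite pE.
  have -> : (sin (b * x + phi) < 0) = (2^-1 * (1 + sin (b * x + phi)) < 2^-1).
    by move: (sin _) => y; apply/idP/idP => ?; lra.
  exact: cvg_power_step.
- move=> n x; rewrite pE; have /andP[w0 w1] := w01 x.
  move: (_ * (1 + _)) w0 w1 => y y0 y1.
  by rewrite ger0_norm ?exprn_ge0 ?exprn_ile1 ?subr_ge0 ?gerBl ?exprn_ge0 ?exprn_ile1.
- exact: finite_measure_integrable_cst.
- exact: finite_measure_integrable_cst.
Qed.

Let same_mean_lt c : same_mean mu nu (fun x => (x < c)%R%:R).
Proof.
apply: (@same_mean_lim _ _ _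
  (fun n x => (sin (n.+1%:R^-1 * x + - (n.+1%:R^-1 * c)) < 0)%R%:R) _ (fun=> 1)).
- by move=> n; exact: same_mean_sin_lt0.
- move=> x; apply: cvg_near_cst; near=> n.
  (* Sine is positive on ]0, 2[ by [sin2_gt0], so within this range the sine has the sign of x -
     c. *)
  have xn : `|x - c| < 2 * n.+1%:R.
    have : `|x - c| < n%:R by near: n; exact: nbhs_infty_gtr.
    have : 0 <= n%:R :> R by []. 
    by rewrite -natr1; move: `|_| => u; lra.
  rewrite -mulrBr; congr ((nat_of_bool _)%:R).
  have d0 : 0 < n.+1%:R^-1 :> R by rewrite invr_gt0.
  have bd : `|n.+1%:R^-1 * (x - c)| < 2.
    by rewrite normrM gtr0_norm// mulrC ltr_pdivrMr.
  have [xc|xc|->] := ltgtP x c; last by rewrite subrr mulr0 sin0 ltxx.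
  + have y0 : n.+1%:R^-1 * (x - c) < 0 by rewrite pmulr_rlt0// subr_lt0.
    rewrite -[_ * _]opprK sinN oppr_lt0 sin2_gt0// oppr_gt0 y0/=.
    by rewrite -(ltr0_norm y0).
  + have y0 : 0 < n.+1%:R^-1 * (x - c) by rewrite mulr_gt0// subr_gt0.
    apply/negbTE; rewrite -leNgt ltW// sin2_gt0// y0/=.
    by rewrite -(gtr0_norm y0).
- by move=> n x; case: (_ < _); rewrite ?normr1 ?normr0.
- exact: finite_measure_integrable_cst.
- exact: finite_measure_integrable_cst.
Unshelve. all: by end_near. Qed.

(** Left half-lines are stable under intersection, cover the line and generate the Borel sets, so
    agreement on them extends to all measurable sets. *)
Lemma probability_eq_sines (A : set R) : measurable A -> mu A = nu A.
Proof.
have mu_lt (m : probability R R) (c : R) :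
    m `]-oo, c[%classic = (\int[m]_x (x < c)%R%:R)%:E.
  rewrite /Rintegral (_ : (fun x => _) = fun x => (\1_(`]-oo, c[%classic) x)%:E).
    rewrite integral_indic// setIT fineK// fin_num_measure//.
  by apply/funext => x; rewrite indicE mem_setE in_itv.
have cover : \bigcup_k `]-oo, k%:R[%classic = [set: R].
  rewrite -subTset => x _; have [k xk] : exists k, x < k%:R :> R.
    exists (Num.bound `|x|); apply: le_lt_trans (ler_norm x) _.
    by apply: archi_boundP.
  by exists k => //=; rewrite in_itv.
move=> mA; refine (@measure_unique _ _ _ (@RGenInftyO.G R)
  (fun k => `]-oo, k%:R[%classic) _ _ _ _ mu nu _ _ A mA).
- exact: RGenInftyO.measurableE.
- move=> _ _ [a ->] [b ->]; exists (Num.min a b).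
  by apply/seteqP; split => x /=; rewrite !in_itv/= lt_min;
    [case=> -> ->|move/andP].
- by move=> i; exists i%:R.
- exact: cover.
- move=> _ [c ->]; apply: etrans (mu_lt mu c) (etrans _ (esym (mu_lt nu c))).
  by case: (same_mean_lt c) => _ _ ->.
- by move=> k; rewrite ltey_eq; apply/orP; left; exact: fin_num_measure.
Qed.

End cdf_from_sines.

(** The Taylor polynomials of 2 cosh (eps x) are nonnegative and increase to it. Their means under
    [mu] equal those under [nu], hence stay below the [nu]-mean of the limit, and monotone
    convergence concludes. *)
Lemma integrable_exp_same_mean {R : realType} (mu nu : probability R R)
    (eps : R) :
  (forall p : {poly R}, same_mean mu nu (horner p)) ->
  nu.-integrable setT
    (EFin \o (fun x => expR (eps * x) + expR (- (eps * x)))) ->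
  mu.-integrable setT
    (EFin \o (fun x => expR (eps * x) + expR (- (eps * x)))).
Proof.
move=> same; set E := (X in EFin \o X) => nuE.
have mE : measurable_fun setT E.
  by apply/measurable_EFinP; exact: measurable_int nuE.
(* The factor 1 + (-1)^k removes the odd powers, so every term is nonnegative at every x. *)
pose p n : {poly R} := \poly_(k < n) ((1 + (-1) ^+ k) * eps ^+ k / k`!%:R).
have term_ge0 k x : 0 <= (1 + (-1) ^+ k) * eps ^+ k / k`!%:R * x ^+ k :> R.
  rewrite -signr_odd; have [ko|ke] := boolP (odd k).
    by rewrite expr1 subrr !mul0r.
  rewrite expr0 mulr_ge0//; last exact: exprn_even_ge0.
  by rewrite divr_ge0// mulr_ge0//; exact: exprn_even_ge0.
have pS n (x : R) : (p n.+1).[x] =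
    (p n).[x] + (1 + (-1) ^+ n) * eps ^+ n / n`!%:R * x ^+ n.
  by rewrite /p !horner_poly big_ord_recr.
have p_ge0 n (x : R) : 0 <= (p n).[x] by rewrite /p horner_poly sumr_ge0.
have p_nd (t : R) : {homo (fun n => (p n).[t]) : n m / (n <= m)%N >-> n <= m}.
  by apply/nondecreasing_seqP => n; rewrite pS lerDl.
have p_cvg (x : R) : (p n).[x] @[n --> \oo] --> E x.
  rewrite (_ : (fun n => _) = fun n => series (exp_coeff (eps * x)) n +
      series (exp_coeff (- (eps * x))) n); last first.
    apply/funext => n; rewrite /series/= !big_mkord -big_split horner_poly/=.
    apply: eq_bigr => k _; by rewrite /exp_coeff/= -(mulN1r (eps * x)) !exprMn;
      ring.
  by apply: cvgD; exact: is_cvg_series_exp_coeff.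
have p_le n (x : R) : (p n).[x] <= E x.
  rewrite -(cvg_lim _ (p_cvg x))//; apply: nondecreasing_cvgn_le => //.
  by apply/cvg_ex; exists (E x).
have E_ge0 x : 0 <= E x by rewrite addr_ge0 ?expR_ge0.
apply/integrableP; split; first exact/measurable_EFinP.
under eq_integral => x _ do rewrite gee0_abs ?lee_fin//.
have int_p n : (\int[mu]_x ((p n).[x])%:E <= \int[nu]_x (E x)%:E)%E.
  have [mup nup] := same (p n); rewrite /Rintegral => eqp.
  rewrite -(fineK (integrable_fin_num measurableT mup)) eqp.
  rewrite (fineK (integrable_fin_num measurableT nup)).
  apply: ge0_le_integral => //.
  - by move=> x _; rewrite lee_fin.
  - exact: measurable_int nup.
  - exact/measurable_EFinP.
  - by move=> x _; rewrite lee_fin.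
have mp n : measurable_fun setT (fun x => ((p n).[x])%:E).
  by apply/measurable_EFinP; exact: measurable_poly.
have p0 n x : setT x -> (0 <= ((p n).[x])%:E)%E by rewrite lee_fin.
have pnd x : setT x -> nondecreasing_seq (fun n => ((p n).[x])%:E).
  by move=> _ m n mn; rewrite lee_fin p_nd.
have EE x : (E x)%:E = limn (fun n => ((p n).[x])%:E).
  by apply/esym/cvg_lim => //; apply: cvg_EFin; [exact: nearW|exact: p_cvg].
rewrite (eq_integral (fun x => limn (fun n => ((p n).[x])%:E))); last first.
  by move=> x _; exact: EE.
rewrite (monotone_convergence mu measurableT mp p0 pnd).
apply: (@le_lt_trans _ _ (\int[nu]_x (E x)%:E)%E).
  apply: lime_le; last exact: nearW.
  apply: ereal_nondecreasing_is_cvgn => m n mn;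
    apply: ge0_le_integral => // x _;
    by rewrite lee_fin ?p_nd.
by rewrite ltey_eq (integrable_fin_num measurableT nuE).
Qed.

(** An exponential moment is asked of [nu] alone; [mu] inherits it from the equality of moments. *)
Theorem moment_determinacy {R : realType} (mu nu : probability R R) (eps : R) :
  0 < eps -> (forall p : {poly R}, same_mean mu nu (horner p)) ->
  nu.-integrable setT
    (EFin \o (fun x => expR (eps * x) + expR (- (eps * x)))) ->
  forall A : set R, measurable A -> mu A = nu A.
Proof.
move=> eps0 same nuE; apply: probability_eq_sines => b phi p.
exact: (same_mean_poly_sin eps0 same (integrable_exp_same_mean same nuE) nuE).
Qed.

(** * Products of independent variables and Gaussian integrals *)

Section image_density.
Import HBSimple HBNNSimple.

(** The hypothesis is the case of an indicator g; simple functions and monotone convergence give the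
    rest. The weight h serves twice: as a density, with X the identity, and as the product of the
    remaining independent factors. *)
Lemma ge0_integral_image_density d (T : measurableType d) (R : realType)
    (m : {measure set T -> \bar R}) (rho : {measure set R -> \bar R})
    (X h : T -> R) (c : R) :
  measurable_fun setT X -> measurable_fun setT h -> (forall w, 0 <= h w) ->
  0 <= c ->
  (forall A, measurable A ->
    (\int[m]_w (\1_A (X w) * h w)%:E = c%:E * rho A)%E) ->
  forall g : R -> R, measurable_fun setT g -> (forall x, 0 <= g x) ->
  (\int[m]_w (g (X w) * h w)%:E = c%:E * \int[rho]_x (g x)%:E)%E.
Proof.
move=> mX mh h0 c0 indA g mg g0.
have simple (f : {nnsfun R >-> R}) :
    (\int[m]_w (f (X w) * h w)%:E = c%:E * \int[rho]_x (f x)%:E)%E.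
  transitivity (\int[m]_w \sum_(y \in range f)
      (y%:E * (\1_(f @^-1` [set y]) (X w) * h w)%:E))%E.
    apply: eq_integral => w _; rewrite fimfunE mulrC mulr_fsumr.
    rewrite -fsumEFin//; apply: eq_fsbigr => y _.
    by rewrite -EFinM; congr EFin; rewrite mulrCA [h w * _]mulrC.
  have mfX y : measurable_fun setT (fun w => \1_(f @^-1` [set y]) (X w) : R).
    by apply: measurableT_comp => //; exact: measurable_indic.
  rewrite ge0_integral_fsum//; last 2 first.
  - move=> y; apply: measurable_funeM; apply/measurable_EFinP.
    exact: measurable_funM.
  - move=> y w _; rewrite EFinM muleA mule_ge0 ?lee_fin//.
    exact: nnfun_muleindic_ge0.
  rewrite integralT_nnsfun sintegralE ge0_mule_fsumr; last first.
    move=> y; exact: nnsfun_mulemu_ge0.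
  apply: eq_fsbigr => y; rewrite inE => -[x _ <-].
  rewrite ge0_integralZl ?lee_fin//.
  - by rewrite indA// muleCA.
  - by apply/measurable_EFinP; exact: measurable_funM.
  - by move=> w _; rewrite lee_fin mulr_ge0// indicE.
have mEg : measurable_fun setT (EFin \o g) by exact/measurable_EFinP.
pose u := nnsfun_approx measurableT mEg.
have u_cvg x : (u n x)%:E @[n --> \oo] --> (g x)%:E.
  by apply: cvg_nnsfun_approx => // y _; rewrite lee_fin.
have u_nd x : {homo (fun n => u n x) : a b / (a <= b)%N >-> a <= b}.
  by move=> a b ab; exact/lefP/nd_nnsfun_approx.
have rhs : (\int[rho]_x (u n x)%:E @[n --> \oo] --> \int[rho]_x (g x)%:E)%E.
  rewrite (eq_integral (fun x => limn (fun n => (u n x)%:E))); last first.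
    by move=> x _; apply/esym/cvg_lim => //; exact: u_cvg.
  apply: cvg_monotone_convergence => //.
  - by move=> n; exact/measurable_EFinP.
  - by move=> n x _; rewrite lee_fin.
  - by move=> x _ a b ab; rewrite lee_fin u_nd.
have lhs : (\int[m]_w (u n (X w) * h w)%:E @[n --> \oo] -->
    \int[m]_w (g (X w) * h w)%:E)%E.
  rewrite (eq_integral (fun w => limn (fun n => (u n (X w) * h w)%:E)));
    last first.
    move=> w _; apply/esym/cvg_lim => //; rewrite EFinM.
    under eq_fun do rewrite EFinM.
    by apply: cvgeZr => //; exact: u_cvg.
  apply: cvg_monotone_convergence => //.
  - move=> n; apply/measurable_EFinP; apply: measurable_funM => //.
    exact: measurableT_comp.
  - by move=> n w _; rewrite lee_fin mulr_ge0.
  - by move=> w _ a b ab; rewrite lee_fin ler_wpM2r// u_nd.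
apply: cvg_unique lhs _ => //; have := cvgeZl (isT : c%:E \is a fin_num) rhs.
by under eq_fun do rewrite -simple.
Qed.

End image_density.

Lemma mutually_independent_prod (R : realType) (disp : measure_display)
    (T : measurableType disp) (P : probability T R) (d : nat)
    (N : 'I_d -> {RV P >-> R}) (g : 'I_d -> R -> R) (e : 'I_d -> R) :
  mutually_independent N ->
  (forall i, measurable_fun setT (g i)) -> (forall i x, 0 <= g i x) ->
  (forall i, \int[P]_w (g i (N i w))%:E = (e i)%:E)%E ->
  (\int[P]_w (\prod_(i < d) g i (N i w))%:E = (\prod_(i < d) e i)%:E)%E.
Proof.
move=> indep.
(* Indicators are replaced by general functions one index at a time. *)
suff gen k : forall (g : 'I_d -> R -> R) (e : 'I_d -> R),
    (forall i, measurable_fun setT (g i)) -> (forall i x, 0 <= g i x) ->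
    (forall i, \int[P]_w (g i (N i w))%:E = (e i)%:E)%E ->
    (forall i : 'I_d, (k <= i)%N -> exists2 A, measurable A & g i = \1_A) ->
    (\int[P]_w (\prod_(i < d) g i (N i w))%:E = (\prod_(i < d) e i)%:E)%E.
  by move=> mg g0 ge; apply: (gen d) => // i; rewrite leqNgt ltn_ord.
elim: k => [|k IHk] {}g {}e mg g0 ge gA.
  have /choice[B BE] : forall i, exists A, measurable A /\ g i = \1_A.
    by move=> i; have [A mA gi] := gA i (leq0n _); exists A.
  have mNB i : measurable (N i @^-1` B i).
    by rewrite -[X in measurable X]setTI; apply: measurable_funP; case: (BE i).
  have eE i : (e i)%:E = P (N i @^-1` B i).
    by rewrite -ge (BE i).2 -[X in P X]setIT -integral_indic.
  rewrite -prodEFin; under [RHS]eq_bigr do rewrite eE.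
  rewrite -indep => [|i]; last by case: (BE i).
  set C := \bigcap_(i in _) _.
  have mC : measurable C.
    by apply: fin_bigcap_measurable => // i _; exact: mNB.
  rewrite -(setIT C) -integral_indic//; apply: eq_integral => w _; congr EFin.
  under eq_bigr do rewrite (BE _).2 indicE.
  rewrite indicE; have [wC|wC] := boolP (w \in C).
    rewrite big1// => i _; rewrite mem_set//.
    by move: wC; rewrite inE => /(_ i); exact.
  have [i /negPf wi] : exists i, N i w \notin B i.
    apply: contrapT => /forallNP wB; move/negP: wC; apply; rewrite inE => i _.
    by have /negP := wB i; rewrite negbK inE.
  by rewrite (bigD1 i)//= wi mul0r.
have [kd|dk] := ltnP k d; last first.
  by apply: IHk => // i ki; have := leq_trans dk ki; rewrite leqNgt ltn_ord.
pose i0 := Ordinal kd.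
have e0 i : 0 <= e i.
  by rewrite -lee_fin -ge; apply: integral_ge0 => w _; rewrite lee_fin.
rewrite (bigD1 i0)//= mulrC EFinM -ge.
under eq_integral do rewrite (bigD1 i0)//=.
have mgN i : measurable_fun setT (fun w => g i (N i w)).
  exact: measurableT_comp.
(* The factor of [i0] is integrated against the law of [N i0], the product of the others being the
   weight; for an indicator in place of [g i0] the claim is the induction hypothesis. *)
rewrite (ge0_integral_image_density (rho := distribution P (N i0))
  (c := \prod_(i < d | i != i0) e i))//.
- rewrite (ge0_integral_distribution (N i0) (f := EFin \o g i0))//.
  + exact/measurable_EFinP.
  + by move=> x; rewrite lee_fin.
- by under eq_fun do rewrite -big_filter; apply: measurable_prod.
- by move=> w; exact: prodr_ge0.
- exact: prodr_ge0.
move=> A mA.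
pose g' i := if i == i0 then \1_A else g i.
pose e' i := if i == i0 then fine (P (N i0 @^-1` A)) else e i.
have mNA : measurable (N i0 @^-1` A).
  by rewrite -[X in measurable X]setTI; apply: measurable_funP.
have eE : (\prod_(i < d) e' i)%:E =
    ((\prod_(i < d | i != i0) e i)%:E * P (N i0 @^-1` A))%E.
  rewrite (bigD1 i0)//= {1}/e' eqxx EFinM fineK ?fin_num_measure// muleC.
  by congr (_%:E * _)%E; apply: eq_bigr => i /negPf ne; rewrite /e' ne.
rewrite -[RHS]eE -(IHk g' e').
- apply: eq_integral => w _; rewrite [in RHS](bigD1 i0)//= {1}/g' eqxx.
  by congr (_ * _)%:E; apply: eq_bigr => i /negPf ne; rewrite /g' ne.
- by move=> i; rewrite /g'; case: eqP => // _; exact: measurable_indic.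
- by move=> i x; rewrite /g'; case: eqP => // _; rewrite indicE.
- move=> i; rewrite /g' /e'; case: eqP => [->|//].
  by rewrite fineK ?fin_num_measure// -[in RHS](setIT (_ @^-1` _)) -integral_indic.
- move=> i ki; rewrite /g'; have [_|ne] := eqVneq i i0; first by exists A.
  apply: gA; rewrite ltn_neqAle ki andbT; apply: contra ne => /eqP kE.
  by apply/eqP/val_inj; rewrite /= -kE.
Qed.

(** * One-dimensional Gaussian integrals *)

Lemma derivable_oo_LRcontinuous_derivable {R : realType} (f : R -> R) (a b : R) :
  (forall x, derivable f x 1) -> derivable_oo_LRcontinuous f a b.
Proof.
move=> df; have cf x : {for x, continuous f}.
  exact/differentiable_continuous/derivable1_diffP.
split; [by []|exact/cvg_at_right_filter/cf|exact/cvg_at_left_filter/cf].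
Qed.

Lemma standard_gaussian_ge0_integral (R : realType) (disp : measure_display)
    (T : measurableType disp) (P : probability T R) (X : {RV P >-> R})
    (g : R -> R) :
  standard_gaussian X -> measurable_fun setT g -> (forall x, 0 <= g x) ->
  (\int[P]_w (g (X w))%:E =
   \int[lebesgue_measure]_x (g x * normal_pdf 0 1 x)%:E)%E.
Proof.
move=> gX mg g0.
have mEg : measurable_fun setT (EFin \o g) by exact/measurable_EFinP.
have g0E y : (0 <= (EFin \o g) y)%E by rewrite lee_fin.
have := ge0_integral_distribution X mEg g0E; rewrite /= => <-.
rewrite (ge0_integral_image_density (rho := distribution P X) (c := 1)) ?mul1e//.
- exact: measurable_normal_pdf.
- by move=> x; exact: normal_pdf_ge0.
move=> A mA; rewrite mul1e [RHS]gX// /normal_prob [RHS]integral_mkcond.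
apply: eq_integral => x _; rewrite patchE indicE.
by case: (x \in A); rewrite ?mul1r ?mul0r.
Qed.

Lemma standard_normal_pdfE {R : realType} (x : R) :
  normal_pdf 0 1 x = normal_peak 1 * expR (- (2^-1 * x ^+ 2)).
Proof.
rewrite normal_pdfE ?oner_eq0// /normal_fun subr0 expr1n.
by rewrite mulNr [_ / _]mulrC.
Qed.

(** exp(a x^2) times the standard density is s times the centred Gaussian density of variance s^2 =
    1 / (1 - 2 a). *)
Lemma integral_exp_sqr_normal_pdf {R : realType} (a : R) : 0 < 1 - 2 * a ->
  (\int[lebesgue_measure]_x (expR (a * (x ^+ 2 - 1)) * normal_pdf 0 1 x)%:E =
   (expR (- a) * (Num.sqrt (1 - 2 * a))^-1)%:E)%E.
Proof.
move=> a1; set s := (Num.sqrt (1 - 2 * a))^-1.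
have q0 : 0 < Num.sqrt (1 - 2 * a) by rewrite sqrtr_gt0.
have s0 : 0 < s by rewrite invr_gt0.
have s2 : s ^+ 2 = (1 - 2 * a)^-1 by rewrite exprVn sqr_sqrtr ?ltW.
have peak : normal_peak 1 = s * normal_peak s.
  rewrite /normal_peak expr1n mul1r -mulrnAr sqrtrM ?sqr_ge0//.
  by rewrite sqrtr_sqr gtr0_norm// invfM mulrA mulfV ?mul1r ?gt_eqF.
transitivity (\int[lebesgue_measure]_x
    ((expR (- a) * s)%:E * (normal_pdf 0 s x)%:E))%E.
  apply: eq_integral => x _; rewrite -EFinM; congr EFin.
  rewrite standard_normal_pdfE normal_pdfE ?gt_eqF// /normal_fun subr0 s2 peak.
  have -> : - x ^+ 2 / ((1 - 2 * a)^-1 *+ 2) = a * x ^+ 2 + - (2^-1 * x ^+ 2).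
    by field; rewrite gt_eqF.
  rewrite mulrBr mulr1 !expRD; ring.
rewrite ge0_integralZl//.
- by rewrite integral_normal_pdf mule1.
- by apply/measurable_EFinP; exact: measurable_normal_pdf.
- by move=> x _; rewrite lee_fin normal_pdf_ge0.
- by rewrite lee_fin mulr_ge0 ?expR_ge0// ltW.
Qed.

(** This controls the boundary term of the integration by parts for even moments. With x = n + 1 and
    y = x^2 / 2, the bound e^y >= y^(k+1) / (k+1)! leaves a constant over x. *)
Lemma cvg_oddX_gauss {R : realType} k :
  n.+1%:R ^+ k.*2.+1 * expR (- (2^-1 * n.+1%:R ^+ 2)) @[n --> \oo] --> (0 : R).
Proof.
pose C : R := (k.+1)`!%:R * 2 ^+ k.+1.
apply: (@squeeze_cvgr _ _ _ _ (fun=> 0) (fun n => C * harmonic n)).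
- apply: nearW => n; rewrite mulr_ge0 ?expR_ge0//=; set x : R := n.+1%:R.
  have x0 : 0 < x by rewrite /x.
  have y0 : 0 < 2^-1 * x ^+ 2 by rewrite mulr_gt0// exprn_gt0.
  have := expR_ge1Dxn k (ltW y0); set y := 2^-1 * x ^+ 2 in y0 * => le1.
  have le2 : y ^+ k.+1 / (k.+1)`!%:R <= expR y by apply: le_trans le1;
    rewrite lerDr.
  have f0 : 0 < (k.+1)`!%:R :> R by rewrite ltr0n fact_gt0.
  have yk : 0 < y ^+ k.+1 / (k.+1)`!%:R by rewrite divr_gt0// exprn_gt0.
  rewrite expRN;
    apply: (@le_trans _ _ (x ^+ k.*2.+1 * (y ^+ k.+1 / (k.+1)`!%:R)^-1)).
    apply: ler_wpM2l; first by rewrite exprn_ge0// ltW.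
    by rewrite lef_pV2// posrE expR_gt0.
  rewrite le_eqVlt; apply/orP; left; apply/eqP.
  have -> : y ^+ k.+1 = x ^+ k.*2.+1 * x / 2 ^+ k.+1.
    by rewrite exprMn exprVn -exprM -exprSr mulrC; congr (x ^+ _ * _);
      rewrite mul2n doubleS.
  rewrite /C; field; rewrite ?gt_eqF//= ?exprn_gt0//.
- exact: cvg_cst.
- by rewrite -(mulr0 C); apply: cvgM; [exact: cvg_cst|exact: cvg_harmonic].
Qed.

(** The double factorial (2k - 1)!!, which is the moment of order 2k of a standard Gaussian
    variable. *)
Definition gauss_moment (R : realType) (k : nat) : R := \prod_(i < k) (i.*2.+1)%:R.

(** Integration by parts with x phi(x) = (- phi)'(x) on growing symmetric intervals produces the
    factor 2k + 1; the boundary terms vanish in the limit. *)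
Lemma integral_even_power_normal_pdf {R : realType} k :
  (\int[lebesgue_measure]_x (x ^+ k.*2 * normal_pdf 0 1 x)%:E =
   (gauss_moment R k)%:E)%E.
Proof.
elim: k => [|k IHk].
  rewrite /gauss_moment big_ord0 -(integral_normal_pdf 0 1).
  by apply: eq_integral => x _; rewrite expr0 mul1r.
pose phi (x : R) : R := normal_peak 1 * expR (- (2^-1 * x ^+ 2)).
have phiE : normal_pdf 0 1 = phi by apply/funext => x;
  exact: standard_normal_pdfE.
(* [n.+1] rather than n keeps the interval nondegenerate, as integration by parts requires. *)
pose I n : set R := `[- n.+1%:R, n.+1%:R]%classic.
have I_cover : \bigcup_n I n = setT.
  rewrite -subTset => x _; exists (Num.bound `|x|) => //=.
  rewrite /I/= in_itv/= -ler_norml (le_trans (ltW (archi_boundP _)))//.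
  by rewrite ler_nat.
have I_nd : {homo I : n m / (n <= m)%N >-> (n <= m)%O}.
  move=> n m nm; apply/subsetPset => x; rewrite /I/= !in_itv/= -!ler_norml.
  by move=> /le_trans; apply; rewrite ler_nat.
have mpow m : measurable_fun [set: R] (fun x : R => x ^+ m * normal_pdf 0 1 x).
  by apply: measurable_funM;
    [exact: measurable_funX|exact: measurable_normal_pdf].
have cvgI m : (\int[lebesgue_measure]_(x in I n) (x ^+ m.*2 * normal_pdf 0 1 x)%:E
    @[n --> \oo] -->
    \int[lebesgue_measure]_x (x ^+ m.*2 * normal_pdf 0 1 x)%:E)%E.
  rewrite -I_cover; apply: ge0_nondecreasing_set_cvg_integral => //.
  - by move=> n; exact: measurable_itv.
  - by move=> n; apply/measurable_EFinP; exact: measurable_funTS (mpow _).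
  - move=> n x _; rewrite lee_fin mulr_ge0 ?normal_pdf_ge0//.
    by rewrite exprn_even_ge0// odd_double.
have dphi (x : R) : is_derive x 1 (- phi) (x * phi x).
  have -> : - phi = (fun=> - normal_peak 1) *
      (expR \o (- (2^-1 \*: (@GRing.exp R ^~ 2)))).
    by apply/funext => y; rewrite /phi /= !fctE mulNr.
  apply: is_derive_eq.
  by rewrite scaler0 addr0 /= !fctE /GRing.scale/= /phi; field.
have dX (x : R) : is_derive x 1 (fun x => x ^+ k.*2.+1) (k.*2.+1%:R * x ^+ k.*2).
  have -> : (fun x : R => x ^+ k.*2.+1) = horner 'X^(k.*2.+1).
    by apply/funext => y; rewrite hornerXn.
  apply: DeriveDef; first exact: derivable_horner.
  by rewrite -derive1E -derivE derivXn hornerMn hornerXn mulr_natl.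
have parts n : (\int[lebesgue_measure]_(x in I n)
      (x ^+ k.+1.*2 * normal_pdf 0 1 x)%:E =
    (- (normal_peak 1 *+ 2 *
      (n.+1%:R ^+ k.*2.+1 * expR (- (2^-1 * n.+1%:R ^+ 2)))))%:E +
    (k.*2.+1%:R)%:E * \int[lebesgue_measure]_(x in I n)
      (x ^+ k.*2 * normal_pdf 0 1 x)%:E)%E.
  have cf (f : R -> R) : (forall x, derivable f x 1) -> continuous f.
    by move=> df x; exact/differentiable_continuous/derivable1_diffP.
  have dXd (x : R) m : derivable (fun x : R => x ^+ m) x 1.
    rewrite (_ : (fun x : R => x ^+ m) = horner 'X^m);
      first exact: derivable_horner.
    by apply/funext => y; rewrite hornerXn.
  have dphid (x : R) : derivable (- phi) x 1 by case: (dphi x).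
  have dphid' (x : R) : derivable phi x 1 by rewrite -[phi]opprK;
    exact: derivableN.
  have nn : - n.+1%:R < n.+1%:R :> R by rewrite gtrN.
  have phiN y : phi (- y) = phi y by rewrite /phi sqrrN.
  transitivity (\int[lebesgue_measure]_(x in I n) (x ^+ k.*2.+1 * (x * phi x))%:E)%E.
    by apply: eq_integral => x _; rewrite phiE mulrA -exprSr doubleS.
  rewrite (integration_by_parts (F := fun x => x ^+ k.*2.+1) (G := - phi)
    (f := fun x => k.*2.+1%:R * x ^+ k.*2) (g := fun x => x * phi x) nn).
  - rewrite phiE /= !fctE phiN exprNn -signr_odd /= odd_double expr1.
    congr (_ + _)%E.
      by congr EFin; rewrite /phi -mulr_natl; ring.
    under eq_integral do rewrite mulrN EFinN.
    rewrite integral_ge0N => [|x _]; last first.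
      by rewrite lee_fin !mulr_ge0// ?expR_ge0 ?normal_peak_ge0//
          exprn_even_ge0// odd_double.
    rewrite oppeK; under eq_integral do rewrite -mulrA EFinM.
    rewrite ge0_integralZl//.
    + by apply/measurable_EFinP; rewrite -phiE;
        exact: measurable_funTS (mpow _).
    + by move=> x _;
        rewrite lee_fin !mulr_ge0// ?expR_ge0 ?normal_peak_ge0//
          exprn_even_ge0// odd_double.
  - apply: continuous_subspaceT => x; apply: cvgM;
      [exact: cvg_cst|exact: (cf _ (dXd^~ _))].
  - exact: derivable_oo_LRcontinuous_derivable.
  - by move=> x _; rewrite derive1E; case: (dX x).
  - apply: continuous_subspaceT => x; apply: cvgM;
      [exact: cvg_id|exact: (cf _ dphid')].
  - exact: derivable_oo_LRcontinuous_derivable.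
  - by move=> x _; rewrite derive1E; case: (dphi x).
have rhs : (((- (normal_peak 1 *+ 2 *
      (n.+1%:R ^+ k.*2.+1 * expR (- (2^-1 * n.+1%:R ^+ 2)))))%:E +
    (k.*2.+1%:R)%:E * \int[lebesgue_measure]_(x in I n)
      (x ^+ k.*2 * normal_pdf 0 1 x)%:E) @[n --> \oo] --> (gauss_moment R k.+1)%:E)%E.
  rewrite /gauss_moment big_ord_recr/= mulrC EFinM -[X in _ --> X]add0e.
  apply: cvgeD => //; last by apply: cvgeZl => //;
    rewrite -/(gauss_moment R k) -IHk.
  apply: cvg_EFin; first exact: nearW.
  rewrite -oppr0 -(mulr0 (normal_peak 1 *+ 2)).
  by apply: cvgN; apply: cvgM; [exact: cvg_cst|exact: cvg_oddX_gauss].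
apply: cvg_unique (cvgI k.+1) _ => //.
by move: rhs; under eq_fun do rewrite -parts.
Qed.

(** * Mixed moments of the N_i^2 and F_infty *)

Lemma mfun_sumE (R : realType) (disp : measure_display)
    (T : measurableType disp) (I : Type) (s : seq I) (f : I -> {mfun T >-> R}) w :
  (\sum_(i <- s) f i) w = \sum_(i <- s) f i w.
Proof. by elim/big_ind2: _ => // _ x _ y <- <-. Qed.

Lemma F_inftyE (R : realType) (disp : measure_display)
    (T : measurableType disp) (P : probability T R) (d : nat)
    (alpha : 'I_d -> R) (N : 'I_d -> {RV P >-> R}) w :
  F_infty alpha N w = \sum_(i < d) alpha i * (N i w ^+ 2 - 1).
Proof. by rewrite /F_infty mfun_sumE. Qed.

Lemma integrable_sum_EFin d (T : measurableType d) (R : realType)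
    (m : {measure set T -> \bar R}) (I : Type) (s : seq I) (f : I -> T -> R) :
  (forall i, m.-integrable setT (EFin \o f i)) ->
  m.-integrable setT (EFin \o (fun x => \sum_(i <- s) f i x)).
Proof.
move=> fi; rewrite (_ : _ \o _ = (fun x => \sum_(i <- s) (EFin \o f i) x)%E).
  exact: integrable_sum.
by apply/funext => x; rewrite /= sumEFin.
Qed.

Lemma Rintegral_sum d (T : measurableType d) (R : realType)
    (m : {measure set T -> \bar R}) (I : Type) (s : seq I) (f : I -> T -> R) :
  (forall i, m.-integrable setT (EFin \o f i)) ->
  \int[m]_x (\sum_(i <- s) f i x) = \sum_(i <- s) \int[m]_x f i x.
Proof.
move=> fi; elim: s => [|i s IHs].
  by under eq_Rintegral do rewrite big_nil;
    rewrite /Rintegral integral0 big_nil.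
under eq_Rintegral do rewrite big_cons.
by rewrite RintegralD ?IHs ?big_cons//; exact: integrable_sum_EFin.
Qed.

Section mixed_moments.
Context (R : realType) (disp : measure_display) (T : measurableType disp).
Context (P : probability T R) (d : nat) (alpha : 'I_d -> R).
Context (N : 'I_d -> {RV P >-> R}).
Hypothesis N_gaussian : forall i, standard_gaussian (N i).
Hypothesis N_indep : mutually_independent N.

Let F := F_infty alpha N.
(* Only even powers, so that the product rule for nonnegative functions of
   independent variables applies. *)
Let mono (k : 'I_d -> nat) w := \prod_(i < d) N i w ^+ (k i).*2.
Let incr (k : 'I_d -> nat) j := fun i => (k i + (i == j))%N.

Let incrC k i j : incr (incr k i) j = incr (incr k j) i.
Proof. by apply/funext => l; rewrite /incr addnAC. Qed.

Let mono_incr k j w : mono (incr k j) w = N j w ^+ 2 * mono k w.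
Proof.
rewrite /mono (bigD1 j)//= [in RHS](bigD1 j)//= /incr eqxx addn1 doubleS.
rewrite -addn2 exprD [_ * _ ^+ 2]mulrC -mulrA; congr (_ * (_ * _)).
by apply: eq_bigr => i /negPf ->; rewrite addn0.
Qed.

Let integral_mono k :
  (\int[P]_w (mono k w)%:E = (\prod_(i < d) gauss_moment R (k i))%:E)%E.
Proof.
apply: (mutually_independent_prod (g := fun i x => x ^+ (k i).*2)) => //.
- by move=> i x; rewrite exprn_even_ge0// odd_double.
- move=> i;
    rewrite (standard_gaussian_ge0_integral (g := fun x => x ^+ (k i).*2))//.
  + exact: integral_even_power_normal_pdf.
  + by move=> x; rewrite exprn_even_ge0// odd_double.
Qed.

(** Expanding one factor F lowers its power while raising exponents of the N_j. Integrability and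
    the recursions on n rest on this identity, with k kept general. *)
Let mono_F k n w : mono k w * F w ^+ n.+1 =
  \sum_(j < d) alpha j * (mono (incr k j) w * F w ^+ n) -
  (\sum_(j < d) alpha j) * (mono k w * F w ^+ n).
Proof.
rewrite exprS [in LHS]/F F_inftyE -/F mulrCA !mulr_suml -sumrB.
by apply: eq_bigr => j _; rewrite mono_incr; ring.
Qed.

Let mono_F_integrable k n :
  P.-integrable setT (EFin \o (fun w => mono k w * F w ^+ n)).
Proof.
elim: n k => [|n IHn] k.
  rewrite (_ : _ \o _ = EFin \o mono k); last first.
    by apply/funext => w; rewrite /= expr0 mulr1.
  have m0 w : 0 <= mono k w.
    by apply: prodr_ge0 => i _; rewrite exprn_even_ge0// odd_double.
  apply/integrableP; split.
    apply/measurable_EFinP; apply: measurable_prod => i _.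
    exact: measurable_funX.
  under eq_integral do rewrite gee0_abs ?lee_fin//.
  by rewrite integral_mono ltry.
rewrite (_ : _ \o _ = (EFin \o (fun w =>
    (\sum_(j < d) alpha j * (mono (incr k j) w * F w ^+ n))%R)) \-
    (fun w => (\sum_(j < d) alpha j)%:E * (mono k w * F w ^+ n)%:E))%E.
  apply: integrableB => //; last exact: (integrableZl _ _ (IHn _)).
  by apply: integrable_sum_EFin => j; exact: (integrableZl _ _ (IHn _)).
by apply/funext => w; rewrite /= mono_F EFinB EFinM.
Qed.

Let I k n := \int[P]_w (mono k w * F w ^+ n).

Let IS k n : I k n.+1 =
  \sum_(j < d) alpha j * I (incr k j) n - (\sum_(j < d) alpha j) * I k n.
Proof.
rewrite /I; under eq_Rintegral do rewrite mono_F.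
rewrite RintegralB//; last 2 first.
- by apply: integrable_sum_EFin => j;
    exact: (integrableZl _ _ (mono_F_integrable _ _)).
- exact: (integrableZl _ _ (mono_F_integrable _ _)).
rewrite RintegralZl// Rintegral_sum => [|j]; last first.
  exact: (integrableZl _ _ (mono_F_integrable _ _)).
by congr (_ - _); apply: eq_bigr => j _; rewrite RintegralZl.
Qed.

Let I0 k i : I (incr k i) 0 = (k i).*2.+1%:R * I k 0.
Proof.
have IE k' : I k' 0 = \prod_(j < d) gauss_moment R (k' j).
  rewrite /I /Rintegral; under eq_integral do rewrite expr0 mulr1.
  by rewrite integral_mono.
rewrite !IE (bigD1 i)//= [in RHS](bigD1 i)//= /incr eqxx addn1.
rewrite /gauss_moment big_ord_recr/= mulrA [_%:R * _]mulrC; congr (_ * _).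
by apply: eq_bigr => j /negPf ->; rewrite addn0.
Qed.

(* Gaussian integration by parts in N_i for the monomials; [n.-1] is harmless at
   n = 0 because of the factor n. *)
Let I_incr i k n : I (incr k i) n - (k i).*2.+1%:R * I k n =
  n%:R * (2 * alpha i) * I (incr k i) n.-1.
Proof.
elim: n k => [|n IHn] k; first by rewrite I0 subrr !mul0r.
rewrite !IS /=.
set A := \sum_(j < d) alpha j.
transitivity (\sum_(j < d) (alpha j *
    (I (incr (incr k i) j) n - (k i).*2.+1%:R * I (incr k j) n)) -
    A * (I (incr k i) n - (k i).*2.+1%:R * I k n)).
  rewrite [in RHS](eq_bigr (fun j => alpha j * I (incr (incr k i) j) n -
    (k i).*2.+1%:R * (alpha j * I (incr k j) n))) => [|j _]; last by ring.
  rewrite sumrB -mulr_sumr; ring.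
(* The induction hypothesis is used at [incr k j]; for j = i its factor is 2 k_i + 3 instead of 2
   k_i + 1, whence the extra term. *)
have step j : I (incr (incr k i) j) n - (k i).*2.+1%:R * I (incr k j) n =
    n%:R * (2 * alpha i) * I (incr (incr k i) j) n.-1 +
    (j == i)%:R * (2 * I (incr k i) n).
  rewrite [in RHS]incrC -IHn incrC /incr; have [->|ne] := eqVneq j i.
    rewrite ?eqxx addn1 mul1r doubleS -!natr1; ring.
  by rewrite ?[i == j]eq_sym ?(negPf ne) addn0 mul0r addr0.
under eq_bigr do rewrite step mulrDr.
rewrite big_split/=.
have -> : \sum_(j < d) alpha j * ((j == i)%:R * (2 * I (incr k i) n)) =
    alpha i * (2 * I (incr k i) n).
  rewrite (bigD1 i)//= eqxx mul1r big1 ?addr0// => j /negPf ->.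
  by rewrite mul0r mulr0.
rewrite IHn.
have -> : \sum_(j < d) alpha j * (n%:R * (2 * alpha i) * I (incr (incr k i) j) n.-1) =
    n%:R * (2 * alpha i) * \sum_(j < d) alpha j * I (incr (incr k i) j) n.-1.
  by rewrite mulr_sumr; apply: eq_bigr => j _; ring.
(* For n > 0 the sum folds back by [IS], and the extra term raises the factor n to n + 1. For n = 0
   the terms with the default predecessor carry the factor 0. *)
case: n => [|n] /= in IHn step *; first by rewrite !mul0r mulr0; ring.
rewrite (_ : \sum_(j < d) alpha j * I (incr (incr k i) j) n =
  I (incr k i) n.+1 + A * I (incr k i) n); last by rewrite IS -/A; ring.
rewrite -[n.+2%:R]natr1; ring.
Qed.

Let mono_horner_integrable k (p : {poly R}) :
  P.-integrable setT (EFin \o (fun w => mono k w * p.[F w])).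
Proof.
under eq_fun do rewrite horner_coef mulr_sumr.
apply: integrable_sum_EFin => n; under eq_fun do rewrite mulrCA.
exact: (integrableZl _ _ (mono_F_integrable k n)).
Qed.

Let mono_hornerE k (p : {poly R}) m : (size p <= m)%N ->
  \int[P]_w (mono k w * p.[F w]) = \sum_(n < m) p`_n * I k n.
Proof.
move=> pm; under eq_Rintegral do rewrite (horner_coef_wide _ pm) mulr_sumr.
under eq_Rintegral do under eq_bigr do rewrite mulrCA.
rewrite Rintegral_sum => [|n];
  last exact: (integrableZl _ _ (mono_F_integrable k n)).
by apply: eq_bigr => n _; rewrite RintegralZl.
Qed.

Let mono0 w : mono (fun=> 0%N) w = 1.
Proof. by rewrite /mono big1// => i _; rewrite expr0. Qed.

Let mono1 i w : mono (incr (fun=> 0%N) i) w = N i w ^+ 2.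
Proof. by rewrite mono_incr mono0 mulr1. Qed.

Lemma integrable_horner_F_infty (p : {poly R}) :
  P.-integrable setT (EFin \o (fun w => p.[F w])).
Proof.
have := mono_horner_integrable (fun=> 0%N) p.
by under eq_fun do rewrite mono0 mul1r.
Qed.

Lemma integrable_sqr_horner_F_infty i (p : {poly R}) :
  P.-integrable setT (EFin \o (fun w => (N i w ^+ 2 - 1) * p.[F w])).
Proof.
rewrite (_ : _ \o _ = (EFin \o (fun w => mono (incr (fun=> 0%N) i) w * p.[F w])%R) \-
    (EFin \o (fun w => p.[F w])))%E; last first.
  by apply/funext => w; rewrite /= mono1 mulrBl mul1r.
apply: integrableB => //; exact: integrable_horner_F_infty.
Qed.

Let sqr_hornerE i (p : {poly R}) :
  \int[P]_w ((N i w ^+ 2 - 1) * p.[F w]) =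
  \int[P]_w (mono (incr (fun=> 0%N) i) w * p.[F w]) - \int[P]_w p.[F w].
Proof.
rewrite -RintegralB//; last exact: integrable_horner_F_infty.
by apply: eq_Rintegral => w _; rewrite mono1 mulrBl mul1r.
Qed.

(** This is [I_incr] at k = 0 weighted by the coefficients of p: the factor n there combines with
    them into the coefficients of the derivative. *)
Lemma sqr_horner_F_infty_deriv i (p : {poly R}) :
  \int[P]_w ((N i w ^+ 2 - 1) * p.[F w]) =
  2 * alpha i * (\int[P]_w ((N i w ^+ 2 - 1) * p^`().[F w]) +
                 \int[P]_w p^`().[F w]).
Proof.
rewrite [in RHS]sqr_hornerE subrK sqr_hornerE.
have -> : \int[P]_w p.[F w] = \int[P]_w (mono (fun=> 0%N) w * p.[F w]).
  by apply: eq_Rintegral => w _; rewrite mono0 mul1r.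
rewrite !(mono_hornerE _ (leqnSn (size p))).
rewrite (@mono_hornerE _ _ (size p)); last first.
  exact: leq_trans (size_poly _ _) (leq_pred _).
rewrite -sumrB (eq_bigr (fun n : 'I_(size p).+1 =>
    p`_n * (n%:R * (2 * alpha i) * I (incr (fun=> 0%N) i) n.-1))) => [|n _].
  rewrite big_ord_recl/= !mul0r mulr0 add0r mulr_sumr; apply: eq_bigr => n _.
  by rewrite coef_deriv /bump/= add1n -mulr_natr; ring.
by rewrite -mulrBr -(I_incr i (fun=> 0%N)) mul1r.
Qed.

Lemma F_infty_horner (p : {poly R}) :
  \int[P]_w (F w * p.[F w]) =
  \sum_(i < d) alpha i * \int[P]_w ((N i w ^+ 2 - 1) * p.[F w]).
Proof.
under eq_Rintegral do rewrite [X in X * _](F_inftyE alpha N) mulr_suml.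
rewrite Rintegral_sum => [|i]; last first.
  under eq_fun do rewrite -mulrA.
  exact: (integrableZl _ _ (integrable_sqr_horner_F_infty i p)).
apply: eq_bigr => i _; under eq_Rintegral do rewrite -mulrA.
by rewrite RintegralZl//; exact: integrable_sqr_horner_F_infty.
Qed.

End mixed_moments.

(** * The Stein identity *)

Lemma derive1n_horner {R : realType} (p : {poly R}) n :
  derive1n n (horner p) = horner p^`(n).
Proof. by elim: n => // n IHn; rewrite derive1nS IHn -derivE. Qed.

(** [stein_op] on formal polynomials, where linearity and degrees are at hand. *)
Definition stein_poly (R : realType) (disp : measure_display)
    (T : measurableType disp) (P : probability T R) (d : nat)
    (alpha : 'I_d -> R) (N : 'I_d -> {RV P >-> R}) (p : {poly R}) : {poly R} :=
  \sum_(2 <= l < d.+2)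
    ((coef_b alpha N l)%:P - coef_a alpha (l - 1) *: 'X) * p^`(d + 2 - l)
  - coef_a alpha d.+1 *: ('X * p).

Lemma stein_op_horner (R : realType) (disp : measure_display)
    (T : measurableType disp) (P : probability T R) (d : nat)
    (alpha : 'I_d -> R) (N : 'I_d -> {RV P >-> R}) (p : {poly R}) x :
  stein_op alpha N (horner p) x = (stein_poly alpha N p).[x].
Proof.
rewrite /stein_op /stein_poly hornerD hornerN hornerZ hornerM hornerX horner_sum mulrA.
congr (_ - _).
by apply: eq_bigr => l _; rewrite derive1n_horner !hornerE.
Qed.

(** * Algebra of the coefficients *)

Lemma P_infty_monic {R : realType} d (alpha : 'I_d -> R) :
  P_infty alpha \is monic.
Proof. by rewrite /P_infty rpredM ?monicX// monic_prod_XsubC. Qed.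

Lemma size_P_infty {R : realType} d (alpha : 'I_d -> R) :
  size (P_infty alpha) = d.+2.
Proof.
rewrite /P_infty mulrC size_mulX ?monic_neq0 ?monic_prod_XsubC//.
by rewrite size_prod_XsubC [index_enum _]unlock -enumT size_enum_ord.
Qed.

Lemma coef_aE {R : realType} d (alpha : 'I_d -> R) l :
  coef_a alpha l = (P_infty alpha)`_l / 2 ^+ l.-1.
Proof.
rewrite /coef_a horner_coef0 coef_derivn addn0 ffactnn subn1.
by rewrite -(mulr_natr (P_infty alpha)`_l) invfM mulrA mulfK.
Qed.

Lemma coef_a_lead_neq0 {R : realType} d (alpha : 'I_d -> R) :
  coef_a alpha d.+1 != 0.
Proof.
rewrite coef_aE; have := P_infty_monic alpha; rewrite monicE lead_coefE.
by rewrite size_P_infty => /eqP ->;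
  rewrite div1r invr_eq0 expf_neq0// pnatr_eq0.
Qed.

(** The powers of 2 cancel those in [coef_a], and P has no constant term, so the sum is P(alpha_i) /
    alpha_i. *)
Lemma coef_a_root {R : realType} d (alpha : 'I_d -> R) i : alpha i != 0 ->
  \sum_(j < d.+1) coef_a alpha (d.+1 - j) * (2 * alpha i) ^+ (d - j) = 0.
Proof.
move=> ai; have : (P_infty alpha).[alpha i] = 0.
  by rewrite /P_infty hornerM horner_prod (bigD1 i)//= hornerXsubC subrr mul0r mulr0.
rewrite horner_coef size_P_infty big_ord_recl coefM big_ord1 coefX mul0r mul0r add0r.
move=> P0; rewrite (reindex_inj rev_ord_inj)/=; apply: (mulfI ai).
rewrite mulr0 -[RHS]P0 mulr_sumr; apply: eq_bigr => j _; rewrite /bump/= ?add1n.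
have jd : (j <= d)%N by rewrite -ltnS.
rewrite subSS subKn// (_ : (d.+1 - (d - j) = j.+1)%N);
  last by rewrite subSn ?leq_subr// subKn.
rewrite coef_aE/= exprMn exprS; field; exact: expf_neq0.
Qed.

(** The recursion pushes each M p^(j) up to order m; at each order n > j it leaves beta^(n-j) L
    p^(n), and coefficients are collected by n. *)
Lemma deriv_recursion_sum {R : realType} (L M : {poly R} -> R) (beta : R)
    (q : nat -> R) (p : {poly R}) :
  (forall p, M p = beta * (M p^`() + L p^`())) ->
  forall m, \sum_(j < m.+1) q j * M p^`(j) =
    (\sum_(j < m.+1) q j * beta ^+ (m - j)) * M p^`(m) +
    \sum_(1 <= n < m.+1) (\sum_(j < n) q j * beta ^+ (n - j)) * L p^`(n).
Proof.
move=> ML; elim=> [|m IHm].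
  by rewrite !big_ord_recl !big_ord0 big_geq// subn0 expr0 mulr1 !addr0.
rewrite big_ord_recr/= IHm [in RHS]big_nat_recr//= [in RHS]big_ord_recr/= subnn expr0.
rewrite ML -derivnS mulr1.
have -> : \sum_(j < m.+1) q j * beta ^+ (m.+1 - j) =
    beta * \sum_(j < m.+1) q j * beta ^+ (m - j).
  rewrite mulr_sumr; apply: eq_bigr => j _; rewrite subSn ?exprS -1?ltnS//;
    ring.
ring.
Qed.

Section stein_identity.
Context (R : realType) (disp : measure_display) (T : measurableType disp).
Context (P : probability T R) (d : nat) (alpha : 'I_d -> R).
Context (N : 'I_d -> {RV P >-> R}).
Hypothesis alpha_neq0 : forall i, alpha i != 0.
Hypothesis N_gaussian : forall i, standard_gaussian (N i).
Hypothesis N_indep : mutually_independent N.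
Let F := F_infty alpha N.
Hypothesis F_cumulant : forall r, (2 <= r)%N ->
  cumulant F r = 2 ^+ r.-1 * (r.-1)`!%:R * \sum_(i < d) alpha i ^+ r.

(** The factorial (r-l+1)! in b_l cancels the one in the cumulant of order r-l+2. With l = d + 2 - n
    and r = d + 1 - j, the inner sum is the coefficient that [deriv_recursion_sum] attaches to L
    p^(n). *)
Let coef_bE n : (1 <= n <= d)%N -> coef_b alpha N (d + 2 - n) =
  \sum_(i < d) alpha i *
    \sum_(j < n) coef_a alpha (d.+1 - j) * (2 * alpha i) ^+ (n - j).
Proof.
move=> /andP[n0 nd]; rewrite /coef_b; set l := (d + 2 - n)%N.
have dl : (d.+2 - l = n)%N by rewrite /l; lia.
rewrite -{1}[l]add0n big_addn dl big_mkord (reindex_inj rev_ord_inj)/=.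
under [RHS]eq_bigr do rewrite mulr_sumr.
rewrite exchange_big/=; apply: eq_bigr => j _; have jn := ltn_ord j.
have -> : (n - j.+1 + l = d.+1 - j)%N by rewrite /l; lia.
have -> : (d.+1 - j - l + 1 = n - j)%N by rewrite /l; lia.
have -> : (d.+1 - j - l + 2 = (n - j).+1)%N by rewrite /l; lia.
rewrite F_cumulant ?ltnS ?subn_gt0//= mulr_sumr mulr_sumr;
  apply: eq_bigr => i _.
have f0 : ((n - j)`!)%:R != 0 :> R by rewrite pnatr_eq0 -lt0n fact_gt0.
by rewrite exprMn exprS; field.
Qed.

Lemma stein_identity (p : {poly R}) :
  \int[P]_w (stein_poly alpha N p).[F w] = 0.
Proof.
pose L p := \int[P]_w p.[F w].
pose M i p := \int[P]_w ((N i w ^+ 2 - 1) * p.[F w]).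
have LX p' : L ('X * p') = \sum_(i < d) alpha i * M i p'.
  rewrite -F_infty_horner// /L; apply: eq_Rintegral => w _.
  by rewrite hornerM hornerX.
have LD p1 p2 : L (p1 + p2) = L p1 + L p2.
  rewrite /L; under eq_Rintegral do rewrite hornerD.
  by rewrite RintegralD//; exact: integrable_horner_F_infty.
have LZ c p1 : L (c *: p1) = c * L p1.
  rewrite /L; under eq_Rintegral do rewrite hornerZ.
  by rewrite RintegralZl//; exact: integrable_horner_F_infty.
have LN p1 : L (- p1) = - L p1 by rewrite -scaleN1r LZ mulN1r.
have Lsum (s : seq nat) (G : nat -> {poly R}) :
    L (\sum_(l <- s) G l) = \sum_(l <- s) L (G l).
  elim: s => [|l s IHs]; last by rewrite !big_cons LD IHs.
  by rewrite !big_nil -(scale0r 0) LZ mul0r.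
have ML i p' : M i p' = 2 * alpha i * (M i p'^`() + L p'^`()).
  exact: sqr_horner_F_infty_deriv.
rewrite -/(L _) /stein_poly LD LN LZ LX Lsum.
(* The sum is reindexed by the order n = d + 2 - l of the derivative, and [LX] trades each factor x
   for the means [M i]. *)
transitivity (\sum_(1 <= n < d.+1) (coef_b alpha N (d + 2 - n) * L p^`(n) -
    coef_a alpha (d.+1 - n) * \sum_(i < d) alpha i * M i p^`(n)) -
    coef_a alpha d.+1 * \sum_(i < d) alpha i * M i p).
  congr (_ - _); rewrite big_nat_rev big_add1/=; apply: eq_big_nat => n nd.
  have -> : (2 + d.+2 - n.+2 = d + 2 - n)%N by lia.
  have -> : (d + 2 - n - 1 = d.+1 - n)%N by lia.
  have -> : (d + 2 - (d + 2 - n) = n)%N by lia.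
  by rewrite mulrBl LD LN mul_polyC LZ -scalerAl LZ LX.
rewrite sumrB.
(* The recursion is run up to order d, where the leftover multiple of M i p^(d) vanishes by
   [coef_a_root]. *)
have -> : \sum_(1 <= n < d.+1) coef_b alpha N (d + 2 - n) * L p^`(n) =
    \sum_(i < d) alpha i * \sum_(j < d.+1) coef_a alpha (d.+1 - j) * M i p^`(j).
  under [RHS]eq_bigr => i _ do
    rewrite (deriv_recursion_sum (fun j => coef_a alpha (d.+1 - j)) p (ML i) d)
      (coef_a_root (alpha_neq0 i)) mul0r add0r mulr_sumr.
  rewrite exchange_big/=; apply: eq_big_nat => n nd.
  rewrite coef_bE ?mulr_suml//; apply: eq_bigr => i _; ring.
have -> : \sum_(i < d) alpha i * \sum_(j < d.+1) coef_a alpha (d.+1 - j) * M i p^`(j) =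
    \sum_(j < d.+1) coef_a alpha (d.+1 - j) * \sum_(i < d) alpha i * M i p^`(j).
  under eq_bigr do rewrite mulr_sumr; rewrite exchange_big/=.
  by apply: eq_bigr => j _; rewrite mulr_sumr; apply: eq_bigr => i _; ring.
(* The term j = 0 cancels the one from a_{d+1} x f(x), the others those of orders 1 to d. *)
rewrite -(big_mkord xpredT (fun j => coef_a alpha (d.+1 - j) *
  \sum_(i < d) alpha i * M i p^`(j))) big_ltn// subn0 derivn0; ring.
Qed.

End stein_identity.

(** * Moment generating function and cumulants *)

Section mgf_F_infty.
Context (R : realType) (disp : measure_display) (T : measurableType disp).
Context (P : probability T R) (d : nat) (alpha : 'I_d -> R).
Context (N : 'I_d -> {RV P >-> R}).
Hypothesis N_gaussian : forall i, standard_gaussian (N i).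
Hypothesis N_indep : mutually_independent N.
Let F := F_infty alpha N.

Lemma expR_half_ln (y : R) : 0 < y -> expR (- (ln y / 2)) = (Num.sqrt y)^-1.
Proof.
move=> y0; rewrite expRN; congr _^-1;
  rewrite -[in RHS](lnK (y0 : y \is Num.pos)).
by rewrite [in RHS](splitr (ln y)) expRD -expr2 sqrtr_sqr ger0_norm.
Qed.

(** Independence reduces this to one-dimensional Gaussian integrals; the exponential form exhibits
    the cumulant generating function. *)
Lemma integral_exp_F_infty (t : R) : (forall i, 0 < 1 - 2 * (t * alpha i)) ->
  (\int[P]_w (expR (t * F w))%:E =
   (expR (\sum_(i < d) (- (t * alpha i) - ln (1 - 2 * (t * alpha i)) / 2)))%:E)%E.
Proof.
move=> t1.
pose g i (x : R) := expR (t * alpha i * (x ^+ 2 - 1)).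
have mg i : measurable_fun setT (g i).
  apply: measurableT_comp => //; apply: measurable_funM => //.
  by apply: measurable_funB => //; exact: measurable_funX.
transitivity (\int[P]_w (\prod_(i < d) g i (N i w))%:E)%E.
  apply: eq_integral => w _; rewrite -expR_sum F_inftyE mulr_sumr.
  by congr (expR _)%:E; apply: eq_bigr => i _; rewrite mulrA.
rewrite (mutually_independent_prod (g := g) (e := fun i =>
  expR (- (t * alpha i)) * (Num.sqrt (1 - 2 * (t * alpha i)))^-1))//.
- rewrite expR_sum; congr EFin; apply: eq_bigr => i _.
  by rewrite expRD expR_half_ln.
- by move=> i x; exact: expR_ge0.
- move=> i; rewrite (standard_gaussian_ge0_integral (g := g i))//.
  + exact: integral_exp_sqr_normal_pdf.
  + by move=> x; exact: expR_ge0.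
Qed.

(** For |t| <= [radius], |t alpha_i| <= 1/4, hence 1 - 2 t alpha_i >= 1/2; the summand 1 keeps the
    inverted quantity positive. *)
Let radius : R := (4 * (1 + \sum_(i < d) `|alpha i|))^-1.

Let radius_gt0 : 0 < radius.
Proof. by rewrite invr_gt0 mulr_gt0// ltr_pwDl// sumr_ge0. Qed.

Let radius_pos (t : R) i : `|t| <= radius -> 0 < 1 - 2 * (t * alpha i).
Proof.
move=> tr; set A := \sum_(i < d) `|alpha i|.
have A0 : 0 <= A by exact: sumr_ge0.
have aA : `|alpha i| <= A by rewrite /A (bigD1 i)//= lerDl sumr_ge0.
have ta : `|t * alpha i| <= 4^-1.
  rewrite normrM; apply: (@le_trans _ _ (radius * (1 + A))).
    by apply: ler_pM => //; rewrite (le_trans aA)// lerDr.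
  by rewrite /radius -/A invfM -mulrA mulVf ?mulr1// gt_eqF// ltr_pwDl.
have := ler_norm (t * alpha i); lra.
Qed.

Lemma integrable_exp_F_infty : exists2 eps : R, 0 < eps &
  P.-integrable setT
    (EFin \o (fun w => expR (eps * F w) + expR (- (eps * F w)))).
Proof.
exists radius => //.
have int t : `|t| <= radius -> P.-integrable setT (fun w => (expR (t * F w))%:E).
  move=> tr; apply/integrableP; split.
    by apply/measurable_EFinP; apply: measurableT_comp => //;
      exact: measurable_funM.
  under eq_integral do rewrite gee0_abs ?lee_fin ?expR_ge0//.
  by rewrite integral_exp_F_infty ?ltry// => i; exact: radius_pos.
rewrite (_ : _ \o _ = (fun w => (expR (radius * F w))%:E) \+
    (fun w => (expR (- radius * F w))%:E))%E; last first.
  by apply/funext => w; rewrite /= mulNr.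
by apply: integrableD => //; apply: int; rewrite ?normrN gtr0_norm.
Qed.

(** Closed form of the s-th derivative of the cumulant generating function near 0. Order 1 is apart
    because of the constant - alpha_i due to centring, which differentiation then removes. *)
Let cumulant_fun s (t : R) : R := match s with
  | 0 => \sum_(i < d) (- (t * alpha i) - ln (1 - 2 * (t * alpha i)) / 2)
  | 1 => \sum_(i < d) (- alpha i + alpha i / (1 - 2 * (t * alpha i)))
  | s'.+1 => 2 ^+ s' * s'`!%:R *
      \sum_(i < d) alpha i ^+ s / (1 - 2 * (t * alpha i)) ^+ s
  end.

Let is_derive_bigsum (f : 'I_d -> R -> R) (df : 'I_d -> R) (t : R) :
  (forall i, is_derive t 1 (f i) (df i)) ->
  is_derive t 1 (fun t => \sum_(i < d) f i t) (\sum_(i < d) df i).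
Proof.
move=> fd; rewrite (_ : (fun t => _) = \sum_(i < d) f i);
  first exact: is_derive_sum.
by apply/funext => x; rewrite fct_sumE.
Qed.

Let base i (t : R) := 1 - 2 * (t * alpha i).

Let is_derive_base i (t : R) : is_derive t 1 (base i) (- (2 * alpha i)).
Proof.
rewrite (_ : base i = horner (1%:P - (2 * alpha i) *: 'X)); last first.
  by apply/funext => x; rewrite /base hornerD hornerN hornerZ hornerX hornerC;
    ring.
apply: DeriveDef; first exact: derivable_horner.
by rewrite -derive1E -derivE derivB derivC derivZ derivX !hornerE.
Qed.

Let is_derive_inv_base i s (t : R) : 0 < base i t ->
  is_derive t 1 (fun t => (base i t ^+ s.+1)^-1)
    (s.+1%:R * (2 * alpha i) / base i t ^+ s.+2).
Proof.
move=> b0; have bn : base i t != 0 by rewrite gt_eqF.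
rewrite (_ : (fun t => _) = (fun t => (base i t)^-1) ^+ s.+1); last first.
  by apply/funext => x; rewrite -exprVn; elim: (s.+1) => // n IHn;
    rewrite !exprS IHn.
have dV := is_deriveV bn (is_derive_base i t).
have dX := is_deriveX s.+1 dV.
apply: is_derive_eq dX _; rewrite /GRing.scale/= exprVn !exprS.
by field; rewrite bn expf_neq0.
Qed.

Let cumulant_funS s (t : R) : `|t| < radius ->
  is_derive t 1 (cumulant_fun s) (cumulant_fun s.+1 t).
Proof.
move=> tr; have pos i : 0 < base i t by exact: radius_pos (ltW tr).
case: s => [|[|s]] /=.
- apply: is_derive_bigsum => i.
  have := is_derive1_comp (is_derive1_ln (pos i)) (is_derive_base i t) => dln.
  rewrite (_ : (fun t => _) =
    (- alpha i) \*: id + (- 2^-1) \*: ((@ln R) \o base i)); last first.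
    by apply/funext => x; rewrite !fctE /= /base /GRing.scale/=; ring.
  apply: is_derive_eq; rewrite /GRing.scale/= -/(base i t).
  by field; rewrite gt_eqF.
- rewrite (_ : 2 ^+ 1 * 1`!%:R * _ =
      \sum_(i < d) (2 * alpha i ^+ 2 / base i t ^+ 2)); last first.
    by rewrite (_ : 1`! = 1%N)// mulr1 expr1 mulr_sumr; apply: eq_bigr => i _;
      rewrite mulrA.
  apply: is_derive_bigsum => i; have dinv := is_derive_inv_base 0 (pos i).
  rewrite (_ : (fun t => _) =
    cst (- alpha i) + alpha i \*: (fun t => (base i t ^+ 1)^-1)); last first.
    by apply/funext => x; rewrite !fctE.
  apply: is_derive_eq; rewrite /GRing.scale/=.
  by field; rewrite gt_eqF.
- pose c : R := 2 ^+ s.+1 * (s.+1)`!%:R.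
  rewrite (_ : _ * \sum_(i < d) _ = c * \sum_(i < d)
      (alpha i ^+ s.+2 * (s.+2%:R * (2 * alpha i) / base i t ^+ s.+3)));
        last first.
    rewrite !mulr_sumr; apply: eq_bigr => i _.
    rewrite /c [(s.+2)`!]factS natrM; have := pos i => bi; rewrite -/(base i t).
    by rewrite !exprS; field; rewrite expf_neq0 ?gt_eqF.
  have dS : is_derive t 1 (fun t => \sum_(i < d) alpha i ^+ s.+2 / (base i t ^+ s.+2))
     (\sum_(i < d)
      (alpha i ^+ s.+2 * (s.+2%:R * (2 * alpha i) / base i t ^+ s.+3))).
    apply: is_derive_bigsum => i; have dinv := is_derive_inv_base s.+1 (pos i).
    exact: (is_deriveZ (alpha i ^+ s.+2) dinv).
  exact: (is_deriveZ c dS).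
Qed.

(** The identity is proved on an open interval rather than at 0 alone, so that the induction can
    differentiate it. *)
Let derive1n_cumulant_fun s (t : R) : `|t| < radius ->
  derive1n s (fun t : R => ln (fine ('M_P F t))) t = cumulant_fun s t.
Proof.
elim: s t => [|s IHs] t tr.
  rewrite derive1n0 /mmt_gen_fun unlock.
  rewrite (_ : (fun w => _) = (fun w => (expR (t * F w))%:E)); last first.
    by apply/funext => w; rewrite /= mulrC.
  rewrite integral_exp_F_infty/= ?expRK// => i; exact: radius_pos (ltW tr).
rewrite derive1nS derive1E.
rewrite (near_eq_derive (g := cumulant_fun s));
  first by case: (cumulant_funS s tr).
near=> u; apply: IHs.
have ut : `|t - u| < radius - `|t|.
  by near: u; apply: (@nbhsx_ballx _ _ t); rewrite subr_gt0.
rewrite -(subKr t u); have := ler_normB t (t - u); lra.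
Unshelve. all: by end_near. Qed.

Lemma cumulant_F_infty r : (2 <= r)%N ->
  cumulant F r = 2 ^+ r.-1 * (r.-1)`!%:R * \sum_(i < d) alpha i ^+ r.
Proof.
case: r => [|[|r]]// _; rewrite /cumulant derive1n_cumulant_fun ?normr0//=.
congr (_ * _); apply: eq_bigr => i _.
by rewrite mul0r mulr0 subr0 expr1n divr1.
Qed.

End mgf_F_infty.

(** * The characterisation *)

(** Nonnegative functions are integrated against the common image law; f is split into positive and
    negative parts. *)
Lemma integral_same_distribution (R : realType) (disp disp' : measure_display)
    (T : measurableType disp) (T' : measurableType disp')
    (P : probability T R) (P' : probability T' R)
    (X : {RV P >-> R}) (Y : {RV P' >-> R}) (f : R -> R) :
  same_distribution X Y -> measurable_fun setT f ->
  (\int[P]_w (f (X w))%:E = \int[P']_w (f (Y w))%:E)%E.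
Proof.
move=> XY mf.
have ge0 (g : R -> \bar R) : measurable_fun setT g -> (forall x, 0 <= g x)%E ->
    (\int[P]_w (g \o X) w = \int[P']_w (g \o Y) w)%E.
  move=> mg g0;
    rewrite -ge0_integral_distribution// -[RHS]ge0_integral_distribution//.
  by apply: eq_measure_integral => A mA _; exact: XY.
have mEf : measurable_fun setT (EFin \o f) by exact/measurable_EFinP.
rewrite integralE [RHS]integralE; congr (_ - _)%E.
- rewrite (eq_integral ((EFin \o f)^\+%E \o X)) => [|w _];
    last by rewrite /= !funeposE.
  rewrite [RHS](eq_integral ((EFin \o f)^\+%E \o Y)) => [|w _];
    last by rewrite /= !funeposE.
  by apply: ge0; [exact: measurable_funepos|exact: funepos_ge0].
- rewrite (eq_integral ((EFin \o f)^\-%E \o X)) => [|w _];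
    last by rewrite /= !funenegE.
  rewrite [RHS](eq_integral ((EFin \o f)^\-%E \o Y)) => [|w _];
    last by rewrite /= !funenegE.
  by apply: ge0; [exact: measurable_funeneg|exact: funeneg_ge0].
Qed.

(* [oo - oo = -oo] in [\bar R], so a finite integral forces both the positive
   and the negative part to have finite integral. *)
Lemma fin_num_integrable d (T : measurableType d) (R : realType)
    (m : {measure set T -> \bar R}) (f : T -> \bar R) :
  measurable_fun setT f -> (\int[m]_x f x)%E \is a fin_num ->
  m.-integrable setT f.
Proof.
move=> mf; rewrite integralE => fin; apply/integrableP; split=> //.
have p0 : (0 <= \int[m]_x f^\+ x)%E by apply: integral_ge0 => x _;
  exact: funepos_ge0.
have n0 : (0 <= \int[m]_x f^\- x)%E by apply: integral_ge0 => x _;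
  exact: funeneg_ge0.
rewrite (eq_integral (f^\+ \+ f^\-)%E) => [|x _]; last first.
  by rewrite -[LHS]/((abse \o f) x) fune_abse.
rewrite ge0_integralD//; last 2 first.
- exact: measurable_funepos.
- exact: measurable_funeneg.
by move: (\int[m]_x f^\+ x)%E (\int[m]_x f^\- x)%E p0 n0 fin
  => [a| |] [b| |]// _ _ _; exact: ltry.
Qed.

(** For 2 <= l <= d + 1 the derivative has order at least 1 and its coefficient degree at most 1, so
    these terms have degree at most n. *)
Lemma stein_poly_Xn (R : realType) (disp : measure_display)
    (T : measurableType disp) (P : probability T R) (d : nat)
    (alpha : 'I_d -> R) (N : 'I_d -> {RV P >-> R}) n :
  exists2 S : {poly R}, (size S <= n.+1)%N &
    stein_poly alpha N 'X^n = S - coef_a alpha d.+1 *: 'X^(n.+1).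
Proof.
rewrite /stein_poly -exprS; eexists; last by [].
rewrite big_seq_cond.
apply: (big_ind (fun q : {poly R} => (size q <= n.+1)%N)).
- by rewrite size_poly0.
- by move=> p q sp sq; rewrite (leq_trans (size_polyD _ _))// geq_max sp.
move=> l; rewrite andbT mem_index_iota => /andP[l2 ld].
(* Orders above n are set apart: the derivative is 0 there, and the subtraction in the exponent
   would be truncated. *)
have [nj|jn] := ltnP n (d + 2 - l).
  by rewrite derivnXn ffact_small// mulr0n mulr0 size_poly0.
have sX : (size (coef_a alpha (l - 1) *: 'X : {poly R}) <= 2)%N.
  by rewrite (leq_trans (size_scale_leq _ _))// size_polyX.
have sb : (size ((coef_b alpha N l)%:P - coef_a alpha (l - 1)%N *: 'X)%R <= 2)%N.
  rewrite (leq_trans (size_polyD _ _))// geq_max size_polyN sX andbT.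
  by rewrite (leq_trans (size_polyC_leq1 _)).
rewrite derivnXn (leq_trans (size_polyMleq _ _))//.
have sm : (size ('X^(n - (d + 2 - l)) *+ n ^_ (d + 2 - l) : {poly R})%R <=
    (n - (d + 2 - l)).+1)%N.
  by rewrite -scaler_nat (leq_trans (size_scale_leq _ _))// size_polyXn.
lia.
Qed.

(** * Recovery of the law from the vanishing means *)

Section stein_characterisation.
Context (R : realType) (disp disp' : measure_display).
Context (T : measurableType disp) (T' : measurableType disp').
Context (P : probability T R) (P' : probability T' R) (d : nat).
Context (alpha : 'I_d -> R) (N : 'I_d -> {RV P' >-> R}) (F : {RV P >-> R}).
Hypothesis alpha_neq0 : forall i, alpha i != 0.
Hypothesis N_gaussian : forall i, standard_gaussian (N i).
Hypothesis N_indep : mutually_independent N.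
Let Y := F_infty alpha N.
Let mu : probability R R := distribution P F.
Let nu : probability R R := distribution P' Y.

Let stein_Y (p : {poly R}) :
  (\int[P']_w ((stein_poly alpha N p).[Y w])%:E = 0)%E.
Proof.
have iY := integrable_horner_F_infty alpha N_gaussian N_indep (stein_poly alpha N p).
rewrite -(fineK (integrable_fin_num measurableT iY)); congr EFin.
apply: stein_identity => // r; exact: cumulant_F_infty.
Qed.

Let integrable_dist (d0 : measure_display) (T0 : measurableType d0)
    (P0 : probability T0 R) (X : {RV P0 >-> R}) (f : R -> R) :
  measurable_fun setT f -> P0.-integrable setT (EFin \o (fun w => f (X w))) ->
  (distribution P0 X).-integrable setT (EFin \o f).
Proof.
move=> mf fi; apply: integrable_pushforward => //.
exact/measurable_EFinP.
Qed.

Hypothesis stein_F : forall p : {poly R},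
  (\int[P]_w ((stein_poly alpha N p).[F w])%:E = 0)%E.

Let same_mean_stein (p : {poly R}) :
  same_mean mu nu (horner (stein_poly alpha N p)).
Proof.
set q := stein_poly alpha N p.
have mq : measurable_fun setT (horner q) by exact: measurable_poly.
have mqE : measurable_fun setT (EFin \o horner q) by exact/measurable_EFinP.
have iF : P.-integrable setT (EFin \o (fun w => q.[F w])).
  (* The vanishing of the mean in the extended reals supplies integrability. *)
  apply: fin_num_integrable; last by rewrite stein_F.
  by apply/measurable_EFinP; exact: measurableT_comp.
have iY := integrable_horner_F_infty alpha N_gaussian N_indep q.
split; [exact: integrable_dist|exact: integrable_dist|].
rewrite /Rintegral integral_distribution// [in RHS]integral_distribution//=.
by rewrite stein_F stein_Y.
Qed.

(** Since a_{d+1} is nonzero, x^(n+1) is a combination of lower powers and of the image of x^n under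
    the operator, all with equal means. *)
Let same_mean_Xn n : same_mean mu nu (fun x => x ^+ n).
Proof.
elim/ltn_ind: n => -[_|n IHn]; first exact: same_mean_cst.
have [S sS SE] := stein_poly_Xn alpha N n.
have a0 := coef_a_lead_neq0 alpha.
have same_S : same_mean mu nu (horner S).
  rewrite (_ : horner S = fun x => \sum_(i < n.+1) S`_i * x ^+ i); last first.
    by apply/funext => x; exact: horner_coef_wide.
  by apply: same_mean_sum => k; apply: same_meanZ; apply: IHn.
have := same_meanZ (coef_a alpha d.+1)^-1
  (same_meanB same_S (same_mean_stein 'X^n)).
rewrite SE (_ : (fun x => _) = fun x => x ^+ n.+1)//; apply/funext => x.
by rewrite !hornerD hornerN hornerZ hornerXn opprB addrC subrK mulKf.
Qed.

Lemma same_distribution_stein : same_distribution F Y.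
Proof.
move=> A mA;
  have [eps eps0 iexp] := integrable_exp_F_infty alpha N_gaussian N_indep.
apply: (moment_determinacy (mu := mu) (nu := nu) eps0) => //.
- move=> p; rewrite (_ : horner p = fun x => \sum_(i < size p) p`_i * x ^+ i);
    last first.
    by apply/funext => x; exact: horner_coef.
  by apply: same_mean_sum => k; apply: same_meanZ; exact: same_mean_Xn.
- apply: integrable_dist iexp.
  have me t : measurable_fun [set: R] (fun x : R => expR (t * x)).
    by apply: measurableT_comp => //; exact: measurable_funM.
  apply: measurable_funD; first exact: me.
  by under eq_fun do rewrite -mulNr; exact: me.
Qed.

End stein_characterisation.

Theorem theorem2p1 (R : realType) (disp disp' : measure_display)
    (T : measurableType disp) (T' : measurableType disp')
    (P : probability T R) (P' : probability T' R)
    (d : nat) (alpha : 'I_d -> R) (N : 'I_d -> {RV P' >-> R})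
    (F : {RV P >-> R})
    (d_ge1 : (1 <= d)%N)
    (alpha_neq0 : forall i, alpha i != 0)
    (alpha_inj : injective alpha)
    (N_gaussian : forall i, standard_gaussian (N i))
    (N_indep : mutually_independent N)
    (F_chaos : in_finite_sum_of_chaoses F)
    (F_centered : ('E_P[F] = 0)%E) :
  same_distribution F (F_infty alpha N) <->
  (forall p : {poly R},
     ('E_P[fun w => stein_op alpha N (horner p) (F w)] = 0)%E).
Proof.
have steinE (p : {poly R}) (X : T -> R) :
    ('E_P[fun w => stein_op alpha N (horner p) (X w)] =
     \int[P]_w ((stein_poly alpha N p).[X w])%:E)%E.
  by rewrite unlock; apply: eq_integral => w _; rewrite stein_op_horner.
split=> [same p|stein].
  rewrite steinE (integral_same_distribution (f := horner _) same); last first.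
    exact: measurable_poly.
  have iY := integrable_horner_F_infty alpha N_gaussian N_indep (stein_poly alpha N p).
  rewrite -(fineK (integrable_fin_num measurableT iY)); congr EFin.
  by apply: stein_identity => // r; exact: cumulant_F_infty.
by apply: same_distribution_stein => // p; rewrite -steinE.
Qed.
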